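(* Let $\lambda_n=2^{n+1}-1$ for all $n\ge0$, and let $\varepsilon=(\varepsilon_n)_{n\ge0}$ be a sequence with values in $\{0,1\}$. For a $2$-adic integer $\omega\in\mathbb{Z}_2$ consider the formal power series with integer coefficients $$Q_{\omega}(X)=\sum_{k\ge 0}\sigma(k,\varepsilon)\binom{\frac{\omega+k}{2}}{k}_2 X^{k}.$$ Then the following hold for every $\omega\in\mathbb{Z}_2$. (1) If $\omega\in\mathbb{Z}$, then $Q_\omega(X)$ is a polynomial; if $\omega\in\mathbb{Z}_2\setminus\mathbb{Z}$, then $Q_\omega(X)$ is transcendental over $\mathbb{Q}(X)$. (2) The series $Q_\omega(X)$ reduced modulo $2$, viewed in $(\mathbb{Z}/2\mathbb{Z})[[X]]$, is algebraic over $(\mathbb{Z}/2\mathbb{Z})(X)$ if and only if $\omega$ is rational (i.e. $\omega\in\mathbb{Q}\cap\mathbb{Z}_2$). This reduced series is rational (i.e. belongs to $(\mathbb{Z}/2\mathbb{Z})(X)$) if and only if it is a polynomial, which happens if and only if $\omega\in\mathbb{Z}$.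
   Context: Notation. For an integer $k\ge 0$ let $e_q(k)\in\{0,1\}$ be its binary digits, $k=\sum_{q\ge0}e_q(k)2^q$. For a $2$-adic integer $\omega=\sum_{i\ge0}\omega_i2^i$ ($\omega_i\in\{0,1\}$) and an integer $k\ge 0$ put $\binom{\omega}{k}_2=\prod_{i\ge0}\binom{\omega_i}{e_i(k)}\in\{0,1\}$; so it equals $1$ if $e_i(k)\le\omega_i$ for all $i$, and $0$ otherwise. By convention $\binom{\frac{\omega+k}{2}}{k}_2=0$ when $\frac{\omega+k}{2}\notin\mathbb{Z}_2$, i.e. when $\omega\not\equiv k \bmod 2$. For a general sequence $(\lambda_n)$ the exponent of $X$ in the $k$-th term of $Q_\omega$ is $\sum_{q\ge0}e_q(k)(\lambda_q-\lambda_{q-1})$ with $\lambda_{-1}=0$; for $\lambda_n=2^{n+1}-1$ this equals $k$. The sign is $\sigma(k,\varepsilon)=(-1)^{\nu(k)+\bar\mu(k,\varepsilon)}\in\{1,-1\}$, where $\nu(k)$ is the number of occurrences of the block $10$ in the usual binary expansion of $k$ (most significant digit first), and $\bar\mu(k,\varepsilon)=\sum_{q\ge0}e_q(k)(\varepsilon_q-\varepsilon_{q-1})$ with $\varepsilon_{-1}=0$. *)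

(* Defs.v *)
From HB Require Import structures.
From mathcomp Require Import all_boot all_order all_algebra.
From mathcomp Require Import boolp.
From mathcomp Require Import zify.

Set Implicit Arguments.
Unset Strict Implicit.
Unset Printing Implicit Defensive.

Import Order.TTheory GRing.Theory Num.Theory.
Local Open Scope ring_scope.

(** * The ring of 2-adic integers, as sequences of binary digits *)

Record Z2adic := MkZ2adic { digit : nat -> bool }.

HB.instance Definition _ := gen_eqMixin Z2adic.
HB.instance Definition _ := gen_choiceMixin Z2adic.

Definition trunc (x : Z2adic) (n : nat) : nat :=
  (\sum_(i < n) digit x i * 2 ^ i)%N.

(* The 2-adic limit of a sequence of naturals [F] with
   [F n.+1 = F n %[mod 2 ^ n]] for all [n]; see [trunc_of_residues]. *)
Definition of_residues (F : nat -> nat) : Z2adic :=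
  MkZ2adic (fun i => odd (F i.+1 %/ 2 ^ i)%N).

Definition Z2zero := MkZ2adic (fun=> false).
Definition Z2one := MkZ2adic (fun i => i == 0%N).
Definition Z2add x y := of_residues (fun n => trunc x n + trunc y n)%N.
Definition Z2mul x y := of_residues (fun n => trunc x n * trunc y n)%N.
(* - x = (digitwise complement of x) + 1 *)
Definition Z2opp x := Z2add (MkZ2adic (fun i => ~~ digit x i)) Z2one.

Section Z2adicRing.
Local Open Scope nat_scope.

Lemma truncS x n : trunc x n.+1 = trunc x n + digit x n * 2 ^ n.
Proof. by rewrite /trunc big_ord_recr. Qed.

Lemma trunc_lt x n : trunc x n < 2 ^ n.
Proof.
elim: n => [|n IHn]; first by rewrite /trunc big_ord0.
rewrite truncS expnS mul2n -addnn; case: (digit x n).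
  by rewrite mul1n ltn_add2r.
by rewrite mul0n addn0 ltn_addr.
Qed.

Lemma trunc_mod x n : trunc x n %% 2 ^ n = trunc x n.
Proof. by rewrite modn_small // trunc_lt. Qed.

Lemma trunc_inj x y : trunc x =1 trunc y -> x = y.
Proof.
case: x y => [f] [g] fg; congr MkZ2adic; apply/funext => i.
have := fg i.+1; rewrite !truncS fg /= => /addnI /eqP.
by rewrite eqn_pmul2r ?expn_gt0 //; case: (f i) (g i) => [] [].
Qed.

Lemma trunc_compat x n : trunc x n.+1 = trunc x n %[mod 2 ^ n].
Proof. by rewrite truncS -modnDmr modnMl addn0. Qed.

Lemma modn_expS m n :
  m %% 2 ^ n.+1 = m %% 2 ^ n + odd (m %/ 2 ^ n) * 2 ^ n.
Proof.
have lt_mod := ltn_pmod m (expn_gt0 2 n : (0 < 2 ^ n) = true).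
rewrite {1}(divn_eq m (2 ^ n)) -{1}[m %/ 2 ^ n]odd_double_half.
rewrite mulnDl -muln2 -mulnA -expnS -addnA addnCA modnMDl addnC.
by rewrite modn_small // expnS; case: odd; lia.
Qed.

Lemma trunc_of_residues F n :
  (forall m, F m.+1 = F m %[mod 2 ^ m]) ->
  trunc (of_residues F) n = F n %% 2 ^ n.
Proof.
move=> FE; elim: n => [|n IHn]; first by rewrite /trunc big_ord0 modn1.
by rewrite truncS IHn modn_expS FE.
Qed.

Lemma trunc0 n : trunc Z2zero n = 0.
Proof. by rewrite /trunc big1. Qed.

Lemma trunc1 n : trunc Z2one n = 1 %% 2 ^ n.
Proof.
case: n => [|n]; first by rewrite /trunc big_ord0 modn1.
rewrite /trunc big_ord_recl /= big1 // addn0 modn_small //.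
by rewrite -{1}(expn0 2) ltn_exp2l.
Qed.

Lemma truncD x y n : trunc (Z2add x y) n = (trunc x n + trunc y n) %% 2 ^ n.
Proof.
apply: trunc_of_residues => m.
by rewrite -modnDm !trunc_compat modnDm.
Qed.

Lemma truncM x y n : trunc (Z2mul x y) n = (trunc x n * trunc y n) %% 2 ^ n.
Proof.
apply: trunc_of_residues => m.
by rewrite -modnMm !trunc_compat modnMm.
Qed.

Lemma truncC x n :
  trunc x n + trunc (MkZ2adic (fun i => ~~ digit x i)) n + 1 = 2 ^ n.
Proof.
elim: n => [|n IHn]; first by rewrite /trunc !big_ord0.
by rewrite !truncS expnS /=; case: (digit x n); lia.
Qed.

Lemma Z2addA : associative Z2add.
Proof.
by move=> x y z; apply: trunc_inj => n; rewrite !truncD modnDmr modnDml addnA.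
Qed.

Lemma Z2addC : commutative Z2add.
Proof. by move=> x y; apply: trunc_inj => n; rewrite !truncD addnC. Qed.

Lemma Z2add0 : left_id Z2zero Z2add.
Proof. by move=> x; apply: trunc_inj => n; rewrite truncD trunc0 trunc_mod. Qed.

Lemma Z2addN : left_inverse Z2zero Z2opp Z2add.
Proof.
move=> x; apply: trunc_inj => n; rewrite /Z2opp !truncD trunc1 trunc0.
by rewrite modnDml addnAC modnDmr addnAC addnC addnA truncC modnn.
Qed.

Lemma Z2mulA : associative Z2mul.
Proof.
by move=> x y z; apply: trunc_inj => n; rewrite !truncM modnMmr modnMml mulnA.
Qed.

Lemma Z2mulC : commutative Z2mul.
Proof. by move=> x y; apply: trunc_inj => n; rewrite !truncM mulnC. Qed.

Lemma Z2mul1 : left_id Z2one Z2mul.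
Proof.
move=> x; apply: trunc_inj => n.
by rewrite truncM trunc1 modnMml mul1n trunc_mod.
Qed.

Lemma Z2mulDl : left_distributive Z2mul Z2add.
Proof.
move=> x y z; apply: trunc_inj => n.
by rewrite truncM !truncD truncM truncM modnMml modnDm mulnDl.
Qed.

Lemma Z2one_neq0 : Z2one != Z2zero.
Proof. by apply/eqP => -[] /(congr1 (@^~ 0)). Qed.

End Z2adicRing.

HB.instance Definition _ :=
  GRing.isZmodule.Build Z2adic Z2addA Z2addC Z2add0 Z2addN.
HB.instance Definition _ :=
  GRing.Zmodule_isComNzRing.Build Z2adic
    Z2mulA Z2mulC Z2mul1 Z2mulDl Z2one_neq0.

Lemma trunc_natr (m n : nat) : trunc m%:R n = (m %% 2 ^ n)%N.
Proof.
elim: m => [|m IHm]; first by rewrite trunc0 mod0n.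
by rewrite -addn1 natrD [LHS]truncD IHm trunc1 modnDm.
Qed.

(* Exact half of an even 2-adic integer. *)
Definition Z2half (x : Z2adic) : Z2adic := MkZ2adic (fun i => digit x i.+1).

Lemma Z2halfK (x : Z2adic) : ~~ digit x 0 -> x = 2%:R * Z2half x.
Proof.
move=> x0.
have truncE n : trunc x n.+1 = (2 * trunc (Z2half x) n)%N.
  rewrite /trunc big_ord_recl (negbTE x0) mul0n add0n big_distrr /=.
  by apply: eq_bigr => i _; rewrite /bump /= expnS mulnCA.
apply: trunc_inj => n; rewrite [RHS]truncM trunc_natr modnMml.
case: n => [|n]; first by rewrite /trunc !big_ord0.
by rewrite truncE truncS mulnDr mulnCA -expnS -modnDmr modnMl addn0 -truncE trunc_mod.
Qed.

Definition Z2_is_int (x : Z2adic) : Prop := exists m : int, x = m%:~R.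

(* x = a / b in the field of 2-adic numbers. *)
Definition Z2_is_rat (x : Z2adic) : Prop :=
  exists a b : int, b != 0 /\ b%:~R * x = a%:~R.

(** * Formal power series *)

Record fps (R : Type) := MkFps { fcoef : nat -> R }.

Lemma fpsP (R : Type) (f g : fps R) : fcoef f =1 fcoef g -> f = g.
Proof. by case: f g => [f] [g] /funext /= ->. Qed.

HB.instance Definition _ (R : Type) := gen_eqMixin (fps R).
HB.instance Definition _ (R : Type) := gen_choiceMixin (fps R).

Definition map_fps (R S : Type) (h : R -> S) (f : fps R) : fps S :=
  MkFps (fun n => h (fcoef f n)).

Definition fps_of_poly (R : nzRingType) (p : {poly R}) : fps R :=
  MkFps (fun n => p`_n).

Section FpsRing.
Variable R : comNzRingType.
Implicit Types f g h : fps R.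

Definition fps0 : fps R := MkFps (fun=> 0).
Definition fps1 : fps R := MkFps (fun n => (n == 0%N)%:R).
Definition fps_add f g := MkFps (fun n => fcoef f n + fcoef g n).
Definition fps_opp f := MkFps (fun n => - fcoef f n).
Definition fps_mul f g :=
  MkFps (fun n => \sum_(i < n.+1) fcoef f i * fcoef g (n - i)).

Definition fps_trunc n f : {poly R} := \poly_(i < n) fcoef f i.

Lemma coef_fps_trunc n f i : (i < n)%N -> (fps_trunc n f)`_i = fcoef f i.
Proof. by move=> lt_in; rewrite coef_poly lt_in. Qed.

Lemma fcoefM f g n i : (i < n)%N ->
  fcoef (fps_mul f g) i = (fps_trunc n f * fps_trunc n g)`_i.
Proof.
move=> lt_in; rewrite coefM; apply: eq_bigr => j _ /=.
have le_ji : (j <= i)%N by rewrite -ltnS.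
by rewrite !coef_fps_trunc //; [apply: leq_ltn_trans (leq_subr _ _) _ | apply: leq_ltn_trans lt_in].
Qed.

Lemma fps_addA : associative fps_add.
Proof. by move=> f g h; apply: fpsP => n /=; rewrite addrA. Qed.
Lemma fps_addC : commutative fps_add.
Proof. by move=> f g; apply: fpsP => n /=; rewrite addrC. Qed.
Lemma fps_add0 : left_id fps0 fps_add.
Proof. by move=> f; apply: fpsP => n /=; rewrite add0r. Qed.
Lemma fps_addN : left_inverse fps0 fps_opp fps_add.
Proof. by move=> f; apply: fpsP => n /=; rewrite addNr. Qed.

Lemma fps_mulA : associative fps_mul.
Proof.
move=> f g h; apply: fpsP => n.
transitivity ((fps_trunc n.+1 f * fps_trunc n.+1 g * fps_trunc n.+1 h)`_n).
  rewrite -mulrA coefM; apply: eq_bigr => i _.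
  by rewrite coef_fps_trunc // (@fcoefM _ _ n.+1) // ltnS leq_subr.
rewrite coefM; apply: eq_bigr => i _.
by rewrite coef_fps_trunc ?ltnS ?leq_subr // (@fcoefM _ _ n.+1).
Qed.

Lemma fps_mulC : commutative fps_mul.
Proof.
by move=> f g; apply: fpsP => n; rewrite !(@fcoefM _ _ n.+1) // mulrC.
Qed.

Lemma fps_mul1 : left_id fps1 fps_mul.
Proof.
move=> f; apply: fpsP => n /=.
rewrite big_ord_recl /= mul1r subn0 big1 ?addr0 // => i _.
by rewrite /bump /= mul0r.
Qed.

Lemma fps_mulDl : left_distributive fps_mul fps_add.
Proof.
move=> f g h; apply: fpsP => n /=; rewrite -big_split /=.
by apply: eq_bigr => i _; rewrite mulrDl.
Qed.

Lemma fps1_neq0 : fps1 != fps0.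
Proof.
by apply/eqP => -[] /(congr1 (@^~ 0%N)) /= /eqP; rewrite (oner_eq0 R).
Qed.

HB.instance Definition _ :=
  GRing.isZmodule.Build (fps R) fps_addA fps_addC fps_add0 fps_addN.
HB.instance Definition _ :=
  GRing.Zmodule_isComNzRing.Build (fps R)
    fps_mulA fps_mulC fps_mul1 fps_mulDl fps1_neq0.

Definition fps_unit : pred (fps R) := fun f => `[< exists g, g * f = 1 >].
Definition fps_inv f : fps R :=
  if pselect (exists g, g * f = 1) is left ex then projT1 (cid ex) else f.

Lemma fps_mulVr : {in fps_unit, left_inverse 1 fps_inv *%R}.
Proof.
move=> f /asboolP ex_g; rewrite /fps_inv; case: pselect => // ex.
by case: (cid ex).
Qed.

Lemma fps_unitP (f g : fps R) : g * f = 1 -> fps_unit f.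
Proof. by move=> gf; apply/asboolP; exists g. Qed.

Lemma fps_inv_out : {in [predC fps_unit], fps_inv =1 id}.
Proof.
move=> f /negP nuf; rewrite /fps_inv; case: pselect => // ex.
by case: nuf; apply/asboolP.
Qed.

HB.instance Definition _ :=
  GRing.ComNzRing_hasMulInverse.Build (fps R) fps_mulVr fps_unitP fps_inv_out.

Fact fps_of_poly_is_zmod_morphism : zmod_morphism (@fps_of_poly R).
Proof. by move=> p q; apply: fpsP => n /=; rewrite coefB. Qed.

Fact fps_of_poly_is_monoid_morphism : monoid_morphism (@fps_of_poly R).
Proof.
split=> [|p q]; apply: fpsP => n /=; first by rewrite coef1.
by rewrite coefM.
Qed.

HB.instance Definition _ :=
  GRing.isZmodMorphism.Build {poly R} (fps R) (@fps_of_poly R)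
    fps_of_poly_is_zmod_morphism.
HB.instance Definition _ :=
  GRing.isMonoidMorphism.Build {poly R} (fps R) (@fps_of_poly R)
    fps_of_poly_is_monoid_morphism.

Lemma fps_of_poly_inj : injective (@fps_of_poly R).
Proof. by move=> p q [] pq; apply/polyP => n; have := congr1 (@^~ n) pq. Qed.

End FpsRing.

Lemma fps_order (R : comNzRingType) (f : fps R) : f != 0 ->
  exists2 n, fcoef f n != 0 & forall i, (i < n)%N -> fcoef f i = 0.
Proof.
move=> nz_f; have ex : exists n, fcoef f n != 0.
  apply: contrapT => nex; case/eqP: nz_f; apply: fpsP => n /=.
  by apply/eqP; apply: contrapT => /negP nz; apply: nex; exists n.
case: (ex_minnP ex) => n nz_n min_n; exists n => // i lt_in.
by apply: contraTeq lt_in => /min_n; rewrite leqNgt.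
Qed.

Lemma fps_integral (R : idomainType) : GRing.integral_domain_axiom (fps R).
Proof.
move=> f g fg0; apply: contraPT fg0; rewrite negb_or => /andP[].
move=> /fps_order[m nz_m min_m] /fps_order[n nz_n min_n] /(congr1 (@fcoef _)).
move=> /(congr1 (@^~ (m + n)%N)) /=.
have lt_m : (m < (m + n).+1)%N by rewrite ltnS leq_addr.
rewrite (bigD1 (Ordinal lt_m)) //= addKn big1 => [|i].
  by rewrite addr0 => /eqP; rewrite mulf_eq0 (negbTE nz_m) (negbTE nz_n).
rewrite -val_eqE /= neq_ltn => /orP[/min_m ->|lt_mi]; first by rewrite mul0r.
by rewrite [fcoef g _]min_n ?mulr0 //; have := ltn_ord i; lia.
Qed.

HB.instance Definition _ (R : idomainType) :=
  GRing.ComUnitRing_isIntegral.Build (fps R) (@fps_integral R).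

(** * Rational and algebraic power series *)

Local Notation "x %:F" := (@FracField.tofrac _ x).

(* K((X)) is the fraction field of K[[X]], and this is the inclusion
   of K(X) into K((X)). *)
Definition frac_to_laurent (K : fieldType) (r : {fraction {poly K}}) :
    {fraction (fps K)} :=
  (fps_of_poly (\n_(repr r)))%:F / (fps_of_poly (\d_(repr r)))%:F.

Lemma fraction_repr (R : idomainType) (x : {fraction R}) :
  x = (\n_(repr x))%:F / (\d_(repr x))%:F.
Proof.
rewrite -[LHS]reprK; set r := repr x; unlock FracField.tofrac.
rewrite -[X in _ * X]FracField.pi_inv -[RHS]FracField.pi_mul.
rewrite /FracField.mulf /FracField.invf !numden_Ratio ?oner_eq0 ?denom_ratioP //.
by rewrite mulr1 mul1r Ratio_numden.
Qed.

Lemma fps_of_poly_eq0 (R : comNzRingType) (p : {poly R}) :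
  (fps_of_poly p == 0) = (p == 0).
Proof. by rewrite -(rmorph0 (@fps_of_poly R)) (inj_eq (@fps_of_poly_inj R)). Qed.

Section FracToLaurent.
Variable K : fieldType.

Lemma frac_to_laurentE (p q : {poly K}) : q != 0 ->
  frac_to_laurent (p%:F / q%:F) = (fps_of_poly p)%:F / (fps_of_poly q)%:F.
Proof.
move=> nz_q; rewrite /frac_to_laurent; set x := p%:F / q%:F.
have nz_d : \d_(repr x) != 0 by exact: denom_ratioP.
have /eqP := fraction_repr x.
rewrite /x eqr_div ?tofrac_eq0 // -!tofracM tofrac_eq => /eqP eq_pq.
apply/eqP; rewrite eqr_div ?tofrac_eq0 ?fps_of_poly_eq0 //.
by rewrite -!tofracM tofrac_eq -!rmorphM eq_pq.
Qed.

Fact frac_to_laurent_is_zmod_morphism : zmod_morphism (@frac_to_laurent K).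
Proof.
move=> x y; have dP (z : {fraction {poly K}}) : \d_(repr z) != 0 := denom_ratioP (repr z).
rewrite {1}(fraction_repr x) {1}(fraction_repr y) -mulNr.
rewrite addf_div ?tofrac_eq0 //.
rewrite -tofracN -!tofracM -tofracD frac_to_laurentE ?mulf_neq0 //.
rewrite rmorphD !rmorphM rmorphN tofracD !tofracM tofracN.
by rewrite /frac_to_laurent -mulNr [RHS]addf_div ?tofrac_eq0 ?fps_of_poly_eq0.
Qed.

Fact frac_to_laurent_is_monoid_morphism : monoid_morphism (@frac_to_laurent K).
Proof.
split=> [|x y].
  rewrite -{1}(divr1 1) -(tofrac1 {poly K}) frac_to_laurentE ?oner_neq0 //.
  by rewrite rmorph1 tofrac1 divr1.
have dP (z : {fraction {poly K}}) : \d_(repr z) != 0 := denom_ratioP (repr z).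
rewrite {1}(fraction_repr x) {1}(fraction_repr y) mulf_div.
rewrite -!tofracM frac_to_laurentE ?mulf_neq0 //.
by rewrite !rmorphM /frac_to_laurent mulf_div.
Qed.

HB.instance Definition _ :=
  GRing.isZmodMorphism.Build {fraction {poly K}} {fraction (fps K)}
    (@frac_to_laurent K) frac_to_laurent_is_zmod_morphism.
HB.instance Definition _ :=
  GRing.isMonoidMorphism.Build {fraction {poly K}} {fraction (fps K)}
    (@frac_to_laurent K) frac_to_laurent_is_monoid_morphism.

End FracToLaurent.

Definition fps_is_poly (R : nzRingType) (f : fps R) : Prop :=
  exists p : {poly R}, f = fps_of_poly p.

Definition fps_rational (K : fieldType) (f : fps K) : Prop :=
  exists r : {fraction {poly K}}, f%:F = frac_to_laurent r.

Definition fps_algebraic (K : fieldType) (f : fps K) : Prop :=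
  algebraicOver (@frac_to_laurent K) f%:F.

Definition fps_transcendental (K : fieldType) (f : fps K) : Prop :=
  ~ fps_algebraic f.

(** * The series Q_omega *)

Definition bdigit (q k : nat) : bool := odd (k %/ 2 ^ q)%N.

(* Digits of [k] of index at least [k] vanish, so that the truncated sums and
   products below, over [q < k], are the full ones over all [q]. *)
Lemma bdigit_out (q k : nat) : (k <= q)%N -> bdigit q k = false.
Proof.
move=> le_kq; rewrite /bdigit divn_small //.
exact: leq_ltn_trans le_kq (ltn_expl q (isT : (1 < 2)%N)).
Qed.

Definition binom2 (x : Z2adic) (k : nat) : nat :=
  (\prod_(i < k) 'C(digit x i, bdigit i k))%N.

(* binom2 ((x + k) / 2) k, which is 0 by convention when x + k is odd. *)
Definition binom2_half (x : Z2adic) (k : nat) : nat :=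
  if digit (x + k%:R) 0 then 0%N else binom2 (Z2half (x + k%:R)) k.

(* Number of blocks 10: digit 1 at position q + 1 followed by digit 0 at q. *)
Definition count10 (k : nat) : nat :=
  (\sum_(q < k) (bdigit q.+1 k && ~~ bdigit q k))%N.

Definition mubar (k : nat) (eps : nat -> bool) : int :=
  \sum_(q < k) (bdigit q k)%:Z *
    ((eps q)%:Z - (if val q is q'.+1 then eps q' else false)%:Z).

Definition sigma (k : nat) (eps : nat -> bool) : int :=
  (-1 : int) ^ ((count10 k)%:Z + mubar k eps).

Definition Qseries (eps : nat -> bool) (omega : Z2adic) : fps int :=
  MkFps (fun k => sigma k eps * (binom2_half omega k)%:Z).

(* Main.v *)
Require Import Defs.
From HB Require Import structures.
From mathcomp Require Import all_boot all_order all_algebra all_field.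
From mathcomp Require Import boolp ring zify.
Import Order.TTheory GRing.Theory Num.Theory.
Set Implicit Arguments.
Unset Strict Implicit.
Unset Printing Implicit Defensive.
Local Open Scope ring_scope.

Local Notation "x %:F" := (@FracField.tofrac _ x).
Local Notation tofrac := (@FracField.tofrac _).

(* Writing Q_w for the series mod 2, the digitwise binomials give
   Q_(2m+1) = X Q_m^2 and Q_(2m) = Q_m^2 + Q_(m-1)^2 (with disjoint supports).
   - Degrees: these recursions bound the degree of Q_w for integral w, and force
     w to be an integer when Q_w is a polynomial.
   - Rationality: Q_w always has arbitrarily long gaps, and a rational series with
     such gaps is a polynomial.
   - Algebraicity for rational w: t_w = X Q_(w-1) satisfies the trace identity
     t_(z+2y) + t_z = t_(z+y) t_y, so t_(nw) is a Dickson polynomial in t_w, and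
     it is a polynomial in X when n w is an integer.
   - Rationality of w: an algebraic series over F_2(X) has a finite orbit under the
     Cartier operators; on Q_w + Q_(w-1) the even Cartier operator acts as a shift
     of w, so the digits of w are eventually periodic.
   - Transcendence over Q(X) (Fatou): if f has bounded integer coefficients and
     satisfies a relation over Z[X] with leading coefficient a, then a f is bounded
     on the open unit disc, hence by Parseval has finitely many nonzero (integer!)
     coefficients. So f is rational, then so is f mod 2, and w is an integer. *)

(** * Digits of 2-adic integers: parity and the form 2x + d *)

Lemma Z2_truncD (x y : Z2adic) (n : nat) :
  trunc (x + y) n = ((trunc x n + trunc y n) %% 2 ^ n)%N.
Proof. exact: Defs.truncD. Qed.

Lemma Z2_truncM (x y : Z2adic) (n : nat) :
  trunc (x * y) n = ((trunc x n * trunc y n) %% 2 ^ n)%N.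
Proof. exact: Defs.truncM. Qed.

Lemma Z2_trunc_digit (x y : Z2adic) (n : nat) :
  trunc x n = trunc y n -> forall i, (i < n)%N -> digit x i = digit y i.
Proof.
elim: n => // n IHn; rewrite !truncS => xy i.
have lt_x := trunc_lt x n; have lt_y := trunc_lt y n.
have [eq_d eq_t]: digit x n = digit y n /\ trunc x n = trunc y n.
  by move: xy; case: (digit x n); case: (digit y n); lia.
by rewrite ltnS leq_eqVlt => /orP[/eqP->|/(IHn eq_t)].
Qed.

Lemma trunc_consS (d : bool) (x : Z2adic) (n : nat) :
  trunc (MkZ2adic (fun i => if i is j.+1 then digit x j else d)) n.+1 =
  (d + 2 * trunc x n)%N.
Proof.
rewrite /trunc big_ord_recl /= muln1 big_distrr; congr (_ + _)%N.
by apply: eq_bigr => i _; rewrite /bump /= expnS mulnCA.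
Qed.

(** Adding d to 2x produces no carry. All later inductions on digits go through this form. *)
Lemma Z2_consE (d : bool) (x : Z2adic) :
  2%:R * x + d%:R = MkZ2adic (fun i => if i is j.+1 then digit x j else d).
Proof.
apply: trunc_inj => -[|n]; first by rewrite /trunc !big_ord0.
rewrite Z2_truncD Z2_truncM !trunc_natr modnDml modnDmr.
rewrite -modnDml modnMml modnDml -[RHS]trunc_mod trunc_consS truncS mulnDr.
by rewrite mulnCA -expnS -addnA (addnCA (2 * _)) modnMDl addnC.
Qed.

Lemma Z2_digit0_cons (d : bool) (x : Z2adic) : digit (2%:R * x + d%:R) 0 = d.
Proof. by rewrite Z2_consE. Qed.

Lemma Z2half_cons (d : bool) (x : Z2adic) : Z2half (2%:R * x + d%:R) = x.
Proof. by rewrite Z2_consE; case: x. Qed.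

Lemma Z2_decomp (x : Z2adic) : x = 2%:R * Z2half x + (digit x 0)%:R.
Proof.
by rewrite Z2_consE; apply: trunc_inj => n; apply: eq_bigr => -[[|i] ?].
Qed.

Lemma Z2_digit0D (x y : Z2adic) : digit (x + y) 0 = digit x 0 (+) digit y 0.
Proof.
rewrite {1}(Z2_decomp x) {1}(Z2_decomp y) addrACA -mulrDr.
set m := Z2half x + Z2half y.
case: (digit x 0) (digit y 0) => [] [].
- rewrite (_ : _ + _ = 2%:R * (m + 1) + false%:R) ?Z2_digit0_cons //.
  by rewrite [true%:R]mulr1n [false%:R]mulr0n; ring.
- by rewrite addr0 Z2_digit0_cons.
- by rewrite add0r Z2_digit0_cons.
- by rewrite add0r Z2_digit0_cons.
Qed.

Lemma Z2_digit0_nat (n : nat) : digit n%:R 0 = odd n.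
Proof.
elim: n => // n IHn; rewrite -addn1 natrD Z2_digit0D IHn oddD.
by rewrite -[1%:R]add0r -(mulr0 2%:R) (Z2_digit0_cons true).
Qed.

Lemma Z2_digit0N (x : Z2adic) : digit (- x) 0 = digit x 0.
Proof.
have := Z2_digit0D x (- x); rewrite subrr (Z2_digit0_nat 0).
by case: (digit x 0); case: (digit (- x) 0).
Qed.

(** * Digit recursions for the coefficients *)

Lemma binom2_rec (x : Z2adic) (k : nat) :
  binom2 x k = ('C(digit x 0, odd k) * binom2 (Z2half x) k./2)%N.
Proof.
(* The range of the product depends on k; it may be enlarged, since the extra factors are C(_, 0) =
   1. *)
have wide n (y : Z2adic) j : (j <= n)%N ->
    binom2 y j = (\prod_(i < n) 'C(digit y i, bdigit i j))%N.
  move=> le_jn; rewrite /binom2 -!(big_mkord xpredT (fun i => 'C(digit y i, bdigit i j))).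
  rewrite (big_cat_nat _ le_jn) //= [X in _ = (_ * X)%N]big1_seq ?muln1 // => i.
  by rewrite mem_index_iota => /= /andP[le_ji _]; rewrite bdigit_out ?bin0.
rewrite (wide k.+1) // (wide k (Z2half x)); last by lia.
rewrite big_ord_recl /= /bdigit divn1; congr (_ * _)%N.
apply: eq_bigr => i _; congr 'C(_, _).
by rewrite /bump /= expnS divnMA divn2.
Qed.

Lemma binom2_half_le1 (x : Z2adic) (k : nat) : (binom2_half x k <= 1)%N.
Proof.
rewrite /binom2_half; case: ifP => // _; rewrite /binom2.
elim/big_ind: _ => // [[|[|m]] [|[|n]]|i _] //.
by case: (digit _ i) (bdigit _ _) => [] [].
Qed.

Lemma binom2_half_odd (x : Z2adic) (k : nat) :
  digit x 0 != odd k -> binom2_half x k = 0%N.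
Proof.
by rewrite /binom2_half Z2_digit0D Z2_digit0_nat; case: digit (odd k) => [] [].
Qed.

Lemma binom2_halfE (x : Z2adic) (k : nat) :
  digit x 0 = odd k -> binom2_half x k = binom2 (Z2half (x + k%:R)) k.
Proof.
by rewrite /binom2_half Z2_digit0D Z2_digit0_nat => ->; rewrite addbb.
Qed.

(** The half sum is x + k + 1, and the low digit 1 of 2k + 1 forces it to be odd, i.e. x + k to be
    even. Dropping its low digit then leaves (x + k) / 2. For x + k odd both sides vanish. *)
Lemma binom2_half_cons1 (x : Z2adic) (k : nat) :
  binom2_half (2%:R * x + 1) k.*2.+1 = binom2_half x k.
Proof.
rewrite binom2_halfE ?(Z2_digit0_cons true) ?oddS ?odd_double //.
have -> : 2%:R * x + 1 + k.*2.+1%:R = 2%:R * (x + k%:R + 1) + false%:R.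
  by rewrite -[k.*2.+1]addn1 -[k.*2]muln2 (natrD _ (k * 2)) natrM addr0; ring.
rewrite Z2half_cons binom2_rec oddS odd_double.
rewrite [k.*2.+1./2]uphalf_double.
rewrite /binom2_half; set y := x + k%:R.
rewrite Z2_digit0D (Z2_digit0_nat 1) addbT; have yE := Z2_decomp y.
case: (digit y 0) yE => yE; first by rewrite bin_small.
rewrite mul1n; congr (binom2 _ k).
by rewrite [in LHS]yE addr0 (Z2half_cons true).
Qed.

(** The half sum is x + k, and the low digit 0 of 2k imposes nothing. Dropping the low digit leaves
    (x + k) / 2 or (x - 1 + k) / 2 according to parity; the other term on the right is 0. *)
Lemma binom2_half_cons0 (x : Z2adic) (k : nat) :
  binom2_half (2%:R * x) k.*2 = (binom2_half x k + binom2_half (x - 1)%R k)%N.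
Proof.
have d0 : digit (2%:R * x) 0 = false.
  by rewrite -[_ * x]addr0 (Z2_digit0_cons false).
rewrite binom2_halfE ?odd_double //.
have -> : 2%:R * x + k.*2%:R = 2%:R * (x + k%:R) + false%:R.
  by rewrite -[k.*2]muln2 natrM addr0; ring.
rewrite Z2half_cons binom2_rec odd_double bin0 mul1n doubleK /binom2_half.
have -> : x - 1 + k%:R = x + k%:R - 1 by ring.
set y := x + k%:R; rewrite Z2_digit0D Z2_digit0N (Z2_digit0_nat 1) addbT.
have yE := Z2_decomp y; case: (digit y 0) yE => yE; last by rewrite addn0.
rewrite add0n; congr (binom2 _ k).
by rewrite [in RHS]yE addrK -[X in _ = Z2half X]addr0 (Z2half_cons false).
Qed.

(** Only the digits 0, ..., k of x + k enter. This is the continuity in x needed for the density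
    argument on traces. *)
Lemma binom2_half_trunc (x y : Z2adic) (k : nat) :
  trunc x k.+1 = trunc y k.+1 -> binom2_half x k = binom2_half y k.
Proof.
move=> xy; have eq_d : forall i, (i < k.+1)%N -> digit (x + k%:R) i = digit (y + k%:R) i.
  by apply: Z2_trunc_digit; rewrite !Z2_truncD xy.
rewrite /binom2_half eq_d //; case: ifP => // _; apply: eq_bigr => i _.
congr 'C(nat_of_bool _, _); exact: (eq_d i.+1 (ltn_ord i)).
Qed.

(* The bound |m + 1| is sharp: the series Q_m has degree |m + 1| - 1. *)
Lemma binom2_half_int (m : int) (k : nat) :
  (`|(m + 1)%R|%N <= k)%N -> binom2_half m%:~R k = 0%N.
Proof.
elim/ltn_ind: k m => k IHk m le_mk.
have [par|] := eqVneq (digit m%:~R 0) (odd k); last exact: binom2_half_odd.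
have [j [d def_m]] : exists j : int, exists d : bool, m = 2 * j + d%:Z.
  by exists (divz m 2), (modz m 2 == 1); lia.
have mE : m%:~R = 2%:R * j%:~R + d%:R :> Z2adic.
  by rewrite def_m intrD intrM; case: d {def_m}.
move: par; rewrite mE Z2_digit0_cons => par.
have kE : k = (d + k./2.*2)%N by rewrite par odd_double_half.
have [k0|k_gt0] := posnP k.
  (* For k = 0 the bound leaves only m = -1, which is odd, so its parity differs from that of k. *)
  by move: kE par; rewrite k0 in le_mk * => _ /= d0; rewrite d0 in def_m; lia.
rewrite kE; case: d def_m {mE par} kE => def_m kE.
  by rewrite add1n binom2_half_cons1 IHk; lia.
rewrite add0n addr0 binom2_half_cons0 IHk; [|lia|lia].
by rewrite -[1]/(1%:~R) -intrB IHk; lia.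
Qed.

(** * Power series over F_2 and squaring *)

Lemma fcoefD (R : comNzRingType) (f g : fps R) (n : nat) :
  fcoef (f + g) n = fcoef f n + fcoef g n.
Proof. by []. Qed.

Lemma fcoef_trunc_mul (R : comNzRingType) (f g : fps R) (n i : nat) :
  (i < n)%N -> fcoef (f * g) i = (fps_trunc n f * fps_trunc n g)`_i.
Proof. exact: fcoefM. Qed.

Lemma fcoef_sum (R : comNzRingType) (I : Type) (r : seq I) (P : pred I)
    (F : I -> fps R) (n : nat) :
  fcoef (\sum_(i <- r | P i) F i) n = \sum_(i <- r | P i) fcoef (F i) n.
Proof. by apply: (big_morph (fun f => fcoef f n)). Qed.

Lemma fcoef_XM0 (R : comNzRingType) (f : fps R) :
  fcoef (fps_of_poly 'X * f) 0 = 0.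
Proof. by rewrite /= big_ord1 coefX mul0r. Qed.

Lemma fcoef_XMS (R : comNzRingType) (f : fps R) (n : nat) :
  fcoef (fps_of_poly 'X * f) n.+1 = fcoef f n.
Proof.
rewrite /= !big_ord_recl /= !coefX mul0r mul1r subSS subn0 add0r big1 ?addr0 //.
by move=> i _; rewrite coefX mul0r.
Qed.

Lemma F2_addrr (c : 'F_2) : c + c = 0.
Proof. by apply: val_inj; case: c => [[|[|[]]]]. Qed.

Lemma F2_sqr (c : 'F_2) : c ^+ 2 = c.
Proof. by apply: val_inj; case: c => [[|[|[]]]]. Qed.

Lemma fps2_addrr (f : fps 'F_2) : f + f = 0.
Proof. by apply: fpsP => n; apply: F2_addrr. Qed.

Lemma fps2_oppr (f : fps 'F_2) : - f = f.
Proof. by apply/esym/eqP; rewrite -addr_eq0 fps2_addrr. Qed.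

Lemma poly2_sqr (p : {poly 'F_2}) : p ^+ 2 = p \Po 'X^2.
Proof.
elim/poly_ind: p => [|p c IHp]; first by rewrite comp_poly0 expr0n.
rewrite sqrrD exprMn IHp comp_polyD comp_polyM comp_polyX comp_polyC.
rewrite -polyC_exp F2_sqr mulr2n; congr (_ + _); rewrite -[RHS]addr0.
by congr (_ + _); apply/polyP => i; rewrite coefD F2_addrr coef0.
Qed.

Lemma fcoef_sqr (f : fps 'F_2) (n : nat) :
  fcoef (f ^+ 2) n = if odd n then 0 else fcoef f n./2.
Proof.
rewrite expr2 (@fcoef_trunc_mul _ _ _ n.+1) // -expr2 poly2_sqr.
rewrite coef_comp_poly_Xn // dvdn2 divn2; case: odd => //=.
by rewrite coef_fps_trunc //; lia.
Qed.

Lemma fcoef_sqr_double (f : fps 'F_2) (n : nat) :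
  fcoef (f ^+ 2) n.*2 = fcoef f n.
Proof. by rewrite fcoef_sqr odd_double doubleK. Qed.

Lemma fcoef_sqr_doubleS (f : fps 'F_2) (n : nat) :
  fcoef (f ^+ 2) n.*2.+1 = 0.
Proof. by rewrite fcoef_sqr oddS odd_double. Qed.

Lemma fpsP_halves (R : Type) (f g : fps R) :
  (forall n, fcoef f n.*2 = fcoef g n.*2) ->
  (forall n, fcoef f n.*2.+1 = fcoef g n.*2.+1) -> f = g.
Proof.
move=> eq0 eq1; apply: fpsP => n; rewrite -(odd_double_half n).
by case: odd; rewrite ?add0n ?add1n.
Qed.

(** * The series Q_w mod 2 and its recursions *)

Definition Q2 (x : Z2adic) : fps 'F_2 := MkFps (fun k => (binom2_half x k)%:R).

Lemma Q2_cons1 (x : Z2adic) :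
  Q2 (2%:R * x + 1) = fps_of_poly 'X * Q2 x ^+ 2.
Proof.
apply: fpsP_halves => n; last first.
  by rewrite fcoef_XMS fcoef_sqr_double [LHS]/= binom2_half_cons1.
rewrite [LHS]/= binom2_half_odd ?(Z2_digit0_cons true) ?odd_double //.
by case: n => [|n]; rewrite ?fcoef_XM0 // doubleS fcoef_XMS fcoef_sqr_doubleS.
Qed.

Lemma Q2_cons0 (x : Z2adic) :
  Q2 (2%:R * x) = Q2 x ^+ 2 + Q2 (x - 1) ^+ 2.
Proof.
apply: fpsP_halves => n; rewrite fcoefD.
  by rewrite !fcoef_sqr_double [LHS]/= binom2_half_cons0 natrD.
rewrite !fcoef_sqr_doubleS addr0 [LHS]/= binom2_half_odd //.
by rewrite -[_ * x]addr0 (Z2_digit0_cons false) oddS odd_double.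
Qed.

Lemma binom2_half_at0 (x : Z2adic) : binom2_half x 0 = ~~ digit x 0.
Proof.
have [d0|d0] := eqVneq (digit x 0) false.
  by rewrite binom2_halfE // d0 /binom2 big_ord0.
by rewrite binom2_half_odd //; case: digit d0.
Qed.

Lemma Q2_at0 (x : Z2adic) : fcoef (Q2 x) 0 = (~~ digit x 0)%:R.
Proof. by rewrite -binom2_half_at0. Qed.

(** The defect [D y] is 0 for even y and equals [D (Z2half y) ^+ 2] for odd y. So coefficient n of a
    defect is 0 or coefficient n/2 of another one, and the descent ends at constant terms, which
    vanish because y + 1 and y - 1 have the same parity. *)
Lemma Q2_rec (x : Z2adic) :
  Q2 (x + 1) + fps_of_poly 'X * Q2 x + Q2 (x - 1) = 0.
Proof.
pose D y := Q2 (y + 1) + fps_of_poly 'X * Q2 y + Q2 (y - 1).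
have D_half y : D y = 0 \/ D y = D (Z2half y) ^+ 2.
  rewrite /D; set m := Z2half y; have yE := Z2_decomp y.
  case: (digit y 0) yE => yE; [right | left]; rewrite {}yE -/m.
    rewrite (_ : _ + 1 + 1 = 2%:R * (m + 1)); last by ring.
    rewrite addrK Q2_cons1 !Q2_cons0 addrK.
    set A := Q2 (m + 1); set B := Q2 m; set C := Q2 (m - 1).
    set Z := fps_of_poly 'X; apply/eqP; rewrite -subr_eq0; apply/eqP.
    (* [ring] ignores characteristic 2, so the 0 on the right is written as u + u with the u that
       makes the identity hold in every commutative ring. *)
    rewrite -(fps2_addrr (B ^+ 2 - Z * A * B - A * C - Z * B * C)); ring.
  rewrite addr0 (_ : _ - 1 = 2%:R * (m - 1) + 1); last by ring.
  rewrite !Q2_cons1 !Q2_cons0.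
  rewrite -(fps2_addrr (fps_of_poly 'X * (Q2 m ^+ 2 + Q2 (m - 1) ^+ 2))); ring.
suff D0 n y : fcoef (D y) n = 0 by apply: fpsP => n; rewrite D0.
elim/ltn_ind: n y => n IHn y; have [n0|n_gt0] := posnP n.
  rewrite n0 !fcoefD fcoef_XM0 addr0 !Q2_at0.
  rewrite (Z2_digit0D y 1) (Z2_digit0D y (- 1)) Z2_digit0N.
  by rewrite F2_addrr.
have [->//|->] := D_half y; rewrite fcoef_sqr; case: odd => //.
by apply: IHn; lia.
Qed.

(** * Algebraic and rational series through polynomial relations *)

Lemma clear_denominators (R : idomainType) (p : {poly {fraction R}}) :
  exists2 d : R, d != 0 & exists q : {poly R}, d%:F *: p = map_poly tofrac q.
Proof.
elim/poly_ind: p => [|p c [d nz_d [q dpE]]].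
  by exists 1; rewrite ?oner_eq0 //; exists 0; rewrite scaler0 rmorph0.
have nz_dc : \d_(repr c) != 0 := denom_ratioP (repr c).
exists (\d_(repr c) * d); first exact: mulf_neq0.
exists (\d_(repr c) *: q * 'X + (d * \n_(repr c))%:P).
rewrite rmorphD [X in _ = X + _]rmorphM /= map_polyZ map_polyX map_polyC /= -dpE.
rewrite scalerDr scalerAl scalerA -tofracM; congr (_ + _).
rewrite -mul_polyC -polyCM; congr (_%:P).
rewrite [X in _ * X = _](fraction_repr c) !tofracM; field.
by rewrite tofrac_eq0.
Qed.

Lemma frac_to_laurent_tofrac (K : fieldType) (p : {poly K}) :
  frac_to_laurent p%:F = (fps_of_poly p)%:F.
Proof.
rewrite -[p%:F]divr1 -(rmorph1 tofrac) frac_to_laurentE ?oner_eq0 //.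
by rewrite !rmorph1 divr1.
Qed.

Lemma horner_frac_to_laurent (K : fieldType) (P : {poly {poly K}}) (f : fps K) :
  (map_poly (@frac_to_laurent K) (map_poly tofrac P)).[f%:F] =
  ((map_poly (@fps_of_poly K) P).[f])%:F.
Proof.
rewrite -horner_map -!map_poly_comp; congr horner.
by apply: eq_map_poly => p /=; exact: frac_to_laurent_tofrac.
Qed.

Lemma fps_algebraicP (K : fieldType) (f : fps K) :
  fps_algebraic f <->
  exists2 P : {poly {poly K}}, P != 0 & (map_poly (@fps_of_poly K) P).[f] = 0.
Proof.
split=> [[p nz_p /rootP pf0]|[P nz_P Pf0]]; last first.
  exists (map_poly tofrac P).
    by rewrite map_poly_eq0_id0 // tofrac_eq0 lead_coef_eq0.
  by apply/rootP; rewrite horner_frac_to_laurent Pf0 rmorph0.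
have [d nz_d [P dpE]] := clear_denominators p; exists P.
  apply: contra_neq nz_p => P0; move/eqP: dpE.
  by rewrite P0 rmorph0 scaler_eq0 tofrac_eq0 (negPf nz_d) => /eqP.
apply/eqP; rewrite -tofrac_eq0 -horner_frac_to_laurent -dpE map_polyZ hornerZ.
by rewrite pf0 mulr0.
Qed.

Lemma fps_rationalP (K : fieldType) (f : fps K) :
  fps_rational f <->
  exists2 q : {poly K}, q != 0 &
    exists p : {poly K}, fps_of_poly q * f = fps_of_poly p.
Proof.
split=> [[r fE]|[q nz_q [p qfE]]].
  exists \d_(repr r); first exact: denom_ratioP.
  exists \n_(repr r); apply/eqP; rewrite -tofrac_eq tofracM fE.
  by rewrite /frac_to_laurent mulrC divfK // tofrac_eq0 fps_of_poly_eq0 denom_ratioP.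
exists (p%:F / q%:F); rewrite frac_to_laurentE // -qfE tofracM.
by rewrite mulrC mulKf // tofrac_eq0 fps_of_poly_eq0.
Qed.

(** * The trace series, and algebraicity for rational w *)

(* With a root [alpha] of [Y^2 + X Y + 1], [trace2 x] is
   [alpha^x + alpha^(-x)]. *)
Definition trace2 (x : Z2adic) : fps 'F_2 := fps_of_poly 'X * Q2 (x - 1).

Lemma Q2_int_poly (m : int) : exists p : {poly 'F_2}, Q2 m%:~R = fps_of_poly p.
Proof.
exists (\poly_(i < `|(m + 1)%R|%N) (binom2_half m%:~R i)%:R).
apply: fpsP => i /=; rewrite coef_poly; case: ltnP => // le_mi.
by rewrite binom2_half_int.
Qed.

Lemma trace2_rec (x : Z2adic) :
  trace2 (x + 1) + trace2 (x - 1) = fps_of_poly 'X * trace2 x.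
Proof.
rewrite /trace2 addrK; apply/eqP; rewrite -subr_eq0 fps2_oppr; apply/eqP.
have := Q2_rec (x - 1); rewrite subrK => rec.
by rewrite -(mulr0 (fps_of_poly 'X)) -rec; ring.
Qed.

Lemma trace2_0 : trace2 0 = 0.
Proof.
rewrite /trace2 (_ : Q2 _ = 0) ?mulr0 //; apply: fpsP => i /=.
by rewrite sub0r -(intrN _ 1) binom2_half_int.
Qed.

Lemma trace2_1 : trace2 1 = fps_of_poly 'X.
Proof.
rewrite /trace2 subrr (_ : Q2 _ = 1) ?mulr1 //; apply: fpsP => -[|i].
  by rewrite Q2_at0 (Z2_digit0_nat 0).
by rewrite /= (binom2_half_int (m := 0)).
Qed.

Lemma trace2_trunc (x y : Z2adic) (n : nat) :
  trunc x n.+2 = trunc y n.+2 -> fcoef (trace2 x) n = fcoef (trace2 y) n.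
Proof.
move=> xy; rewrite /trace2; case: n xy => [|n] xy; first by rewrite !fcoef_XM0.
rewrite !fcoef_XMS; congr _%:R; apply: binom2_half_trunc.
have trunc_le z m : trunc z m = (trunc z m.+1 %% 2 ^ m)%N.
  by rewrite trunc_compat trunc_mod.
by rewrite !Z2_truncD (trunc_le x) (trunc_le y) (trunc_le x) (trunc_le y) xy.
Qed.

Lemma trace2E (x : Z2adic) : trace2 (x + 1) = fps_of_poly 'X * Q2 x.
Proof. by rewrite /trace2 addrK. Qed.

Opaque trace2.

(** Centred at x = z + n, both sides satisfy the same second order recursion in n; hence the
    induction on two consecutive values. *)
Lemma trace2_addn (z : Z2adic) (n : nat) :
  trace2 (z + n%:R + n%:R) + trace2 z = trace2 (z + n%:R) * trace2 n%:R.
Proof.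
suff H x : trace2 (x + n%:R) + trace2 (x - n%:R) = trace2 x * trace2 n%:R.
  by rewrite -H addrK.
suff [] : trace2 (x + n%:R) + trace2 (x - n%:R) = trace2 x * trace2 n%:R /\
  trace2 (x + n.+1%:R) + trace2 (x - n.+1%:R) = trace2 x * trace2 n.+1%:R by [].
elim: n => [|n [IH1 IH2]].
  by rewrite addr0 subr0 fps2_addrr trace2_0 mulr0 trace2_1 trace2_rec mulrC.
split=> //.
have recp y : trace2 (y + 1 + 1) = fps_of_poly 'X * trace2 (y + 1) - trace2 y.
  by rewrite -trace2_rec addrK addrK.
have recm y : trace2 (y - 1 - 1) = fps_of_poly 'X * trace2 (y - 1) - trace2 y.
  by rewrite -trace2_rec subrK [RHS]addrC addKr.
have -> : x + n.+2%:R = x + n%:R + 1 + 1 by rewrite -[n.+2]addn2 natrD; ring.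
have -> : x - n.+2%:R = x - n%:R - 1 - 1 by rewrite -[n.+2]addn2 natrD; ring.
rewrite -[n.+2%:R]natr1 -[n.+1%:R]natr1 recm !recp natr1.
have <- : x + n.+1%:R = x + n%:R + 1 by rewrite -natr1 addrA.
have <- : x - n.+1%:R = x - n%:R - 1 by rewrite -natr1; ring.
by rewrite mulrBr [trace2 x * (_ * _)]mulrCA -IH1 -IH2 mulrDr opprD addrACA.
Qed.

(* Both sides depend continuously on y, and naturals are dense in Z_2. *)
Lemma trace2_add (z y : Z2adic) :
  trace2 (z + y + y) + trace2 z = trace2 (z + y) * trace2 y.
Proof.
(* The natural number m agrees with y on n + 2 digits, so replacing y by m changes no coefficient of
   index at most n. *)
apply: fpsP => n; pose m : Z2adic := (trunc y n.+2)%:R.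
have ym k : (k <= n.+2)%N -> trunc m k = trunc y k.
  move=> le_kn; rewrite trunc_natr -(subnK le_kn); elim: (n.+2 - k)%N => [|j IHj].
    by rewrite trunc_mod.
  rewrite addSn truncS -modnDmr.
  by rewrite (eqP (dvdn_mull _ (dvdn_exp2l _ (leq_addl _ _)))) addn0.
have eq_t u v : (forall k, (k <= n.+2)%N -> trunc u k = trunc v k) ->
  forall k, (k <= n)%N -> fcoef (trace2 u) k = fcoef (trace2 v) k.
  by move=> uv k le_kn; apply: trace2_trunc; apply: uv.
have addm u v k : (forall k, (k <= n.+2)%N -> trunc u k = trunc v k) ->
    (k <= n.+2)%N -> trunc (u + m) k = trunc (v + y) k.
  by move=> uv le_kn; rewrite !Z2_truncD uv ?ym.
have zym k : (k <= n.+2)%N -> trunc (z + m) k = trunc (z + y) k by apply: addm.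
transitivity (fcoef (trace2 (z + m) * trace2 m) n).
  rewrite -(trace2_addn z (trunc y n.+2)) !fcoefD; congr (_ + _).
  by apply: esym; apply: eq_t => // k; apply: addm.
by apply: eq_bigr => i _; congr (_ * _); apply: eq_t => //; have := ltn_ord i; lia.
Qed.

(** These are the Dickson polynomials: the trace identity with y = x and z = n x gives p_(n+2) =
    p_(n+1) Y - p_n. The exact size is recorded so that p stays nonzero after subtraction of a
    constant. *)
Lemma trace2_muln (n : nat) :
  exists2 p : {poly {poly 'F_2}}, size p = n.+2 &
    forall x, trace2 (n.+1%:R * x) = (map_poly (@fps_of_poly 'F_2) p).[trace2 x].
Proof.
pose ev p x := (map_poly (@fps_of_poly 'F_2) p).[trace2 x].
suff [p _ [p' ? ?]] : exists2 p : {poly {poly 'F_2}},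
    (size p <= n.+1)%N /\ (forall x, trace2 (n%:R * x) = ev p x) &
    exists2 p' : {poly {poly 'F_2}}, size p' = n.+2 &
      forall x, trace2 (n.+1%:R * x) = ev p' x by exists p'.
elim: n => [|n [p [sz_p pE] [p' sz_p' p'E]]].
  (* The Dickson polynomial of index 0 is the constant 2, which is 0 here. *)
  exists 0.
    by split=> [|x]; rewrite ?size_poly0 // mul0r trace2_0 /ev rmorph0 horner0.
  by exists 'X => [|x]; rewrite ?size_polyX // mul1r /ev map_polyX hornerX.
exists p'; first by rewrite sz_p'.
exists (p' * 'X - p) => [|x].
  have nz_p' : p' != 0 by rewrite -size_poly_gt0 sz_p'.
  by rewrite size_polyDl size_mulX ?sz_p' // size_polyN ltnS (leq_trans sz_p).
have eq1 : n.+1%:R * x = n%:R * x + x by rewrite -natr1 mulrDl mul1r.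
have -> : n.+2%:R * x = n%:R * x + x + x by rewrite -natr1 mulrDl mul1r eq1.
rewrite /ev rmorphB rmorphM /= map_polyX hornerD hornerN hornerMX.
by rewrite -/(ev _ _) -/(ev _ _) -p'E -pE eq1 -trace2_add addrK.
Qed.

Lemma fps_of_poly_algebraic (K : fieldType) (p : {poly K}) :
  fps_algebraic (fps_of_poly p).
Proof.
apply/fps_algebraicP; exists ('X - p%:P); first by rewrite polyXsubC_eq0.
by rewrite rmorphB /= map_polyX map_polyC hornerXsubC subrr.
Qed.

Lemma Q2_algebraic (x : Z2adic) : Z2_is_rat x -> fps_algebraic (Q2 x).
Proof.
case=> a [b [nz_b bxE]].
have alg_t : fps_algebraic (trace2 (x + 1)).
  (* Here n + 1 = |b|; the shift to x + 1 fits t_(x+1) = X Q_x. *)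
  have [n [c bxE']] : exists n : nat, exists c : int, n.+1%:R * (x + 1) = c%:~R.
    case: b nz_b bxE => [[|n]|n] // _ bxE; exists n.
      by exists (a + n.+1); rewrite mulrDr mulr1 intrD -bxE.
    exists (n.+1%:Z - a); rewrite mulrDr mulr1 intrB -bxE.
    by rewrite NegzE mulrNz mulNr opprK addrC.
  have [p sz_p pE] := trace2_muln n; have [q qE] := Q2_int_poly (c - 1).
  (* Since t_c = X Q_(c-1) is a polynomial in X, this polynomial has the root t_(x+1). *)
  apply/fps_algebraicP; exists (p - ('X * q)%:P).
    rewrite -size_poly_eq0 size_polyDl ?sz_p // size_polyN.
    exact: leq_ltn_trans (size_polyC_leq1 _) _.
  rewrite rmorphB /= map_polyC /= hornerD hornerN hornerC -pE bxE'.
  rewrite -(subrK 1 c) intrD trace2E qE.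
  by rewrite rmorphM subrr.
have alg_X := fps_of_poly_algebraic ('X : {poly 'F_2}).
have nzX : (fps_of_poly ('X : {poly 'F_2}))%:F != 0.
  by rewrite tofrac_eq0 fps_of_poly_eq0 polyX_eq0.
rewrite /fps_algebraic -[X in algebraicOver _ X](mulKf nzX) -tofracM -trace2E mulrC.
apply: (algebraic_div alg_t alg_X).
Qed.

(** * A polynomial series forces an integer w *)

(** The vanishing constant term makes x odd, and Q_(2m+1) = X Q_m^2 passes the vanishing on to m. So
    all digits are 1. *)
Lemma Q2_eq0 (x : Z2adic) : (forall k, binom2_half x k = 0%N) -> x = - 1.
Proof.
move=> x0; apply: trunc_inj => n; elim: n x x0 => [|n IHn] x x0.
  by rewrite /trunc !big_ord0.
have dx : digit x 0 = true.
  by have := binom2_half_at0 x; rewrite x0; case: (digit x 0).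
have xE := Z2_decomp x; rewrite dx in xE.
have -> : - 1 = 2%:R * - 1 + true%:R :> Z2adic by rewrite [true%:R]mulr1n; ring.
rewrite xE !Z2_consE !trunc_consS IHn // => k.
by rewrite -binom2_half_cons1 -[1]/(true%:R) -xE.
Qed.

Lemma Z2_is_int_cons (d : bool) (x : Z2adic) :
  Z2_is_int x -> Z2_is_int (2%:R * x + d%:R).
Proof.
by case=> m ->; exists (2 * m + d%:Z); rewrite intrD intrM -pmulrn; case: d.
Qed.

Lemma Z2_is_intD1 (x : Z2adic) : Z2_is_int (x - 1) -> Z2_is_int x.
Proof. by case=> m xE; exists (m + 1); rewrite intrD -xE subrK. Qed.

(** Induction on the degree bound D: the recursions roughly halve it when x is replaced by its half,
    and D = 0 gives x = -1. *)
Lemma binom2_half_finite_int (x : Z2adic) (D : nat) :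
  (forall k, (D <= k)%N -> binom2_half x k = 0%N) -> Z2_is_int x.
Proof.
elim/ltn_ind: D x => D IHD x x0; have [D0|D_gt0] := posnP D.
  by exists (-1); rewrite [x]Q2_eq0 // => k; rewrite x0 // D0.
have xE := Z2_decomp x; rewrite xE; set m := Z2half x in xE *.
case: (digit x 0) xE => xE; apply: Z2_is_int_cons.
  apply: (IHD D./2); first by lia.
  move=> k le_k; rewrite -binom2_half_cons1 -[1]/(true%:R) -xE x0 //; lia.
rewrite addr0 in xE.
have m0 k : (D <= k.*2)%N -> binom2_half m k = 0%N /\ binom2_half (m - 1) k = 0%N.
  move=> le_k; have := x0 _ le_k; rewrite xE binom2_half_cons0 => /eqP.
  by rewrite addn_eq0 => /andP[/eqP-> /eqP->].
(* The new bound, D/2 rounded up, is smaller except at D = 1. There the odd one of m and m - 1 also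
   has constant term 0, so the bound 0 applies to it. *)
have [D1|D_neq1] := eqVneq D 1%N; last first.
  by apply: (IHD (uphalf D)); [lia | move=> k le_k; apply: (proj1 (m0 k _)); lia].
have := Z2_digit0D m (- 1); rewrite Z2_digit0N (Z2_digit0_nat 1) addbT.
case dm : (digit m 0) => dm1; [|apply: Z2_is_intD1]; apply: (IHD 0%N) => // -[|k] _.
- by rewrite binom2_half_at0 dm.
- by apply: (proj1 (m0 _ _)); lia.
- by rewrite binom2_half_at0 dm1.
- by apply: (proj2 (m0 _ _)); lia.
Qed.

(** * Gaps, and rational series that are polynomials *)

(** The pair {2m + d, 2m + d - 1} is reached from {m, m - 1} alone, since 2m - 1 = 2(m - 1) + 1.
    Common zeros thus lift from k/2 to k, and gaps double. *)
Lemma binom2_half_pair0 (d : bool) (x : Z2adic) (k : nat) :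
  binom2_half x k./2 = 0%N /\ binom2_half (x - 1) k./2 = 0%N ->
  binom2_half (2%:R * x + d%:R) k = 0%N /\
  binom2_half (2%:R * x + d%:R - 1) k = 0%N.
Proof.
move=> [x0 x10]; have even0 : binom2_half (2%:R * x) k = 0%N.
  have [par|] := eqVneq (digit (2%:R * x) 0) (odd k); last exact: binom2_half_odd.
  have : odd k = false by rewrite -par -[_ * x]addr0 (Z2_digit0_cons false).
  by move=> ek; rewrite -(odd_double_half k) ek binom2_half_cons0 x0 x10.
have odd0 y : binom2_half y k./2 = 0%N -> binom2_half (2%:R * y + 1) k = 0%N.
  have [par|] := eqVneq (digit (2%:R * y + 1) 0) (odd k); last first.
    by move=> ? _; apply: binom2_half_odd.
  have : odd k = true by rewrite -par (Z2_digit0_cons true).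
  by move=> ok y0; rewrite -(odd_double_half k) ok binom2_half_cons1.
case: d; first by rewrite addrK; split=> //; apply: odd0.
rewrite addr0 (_ : 2%:R * x - 1 = 2%:R * (x - 1) + 1); last by ring.
by split=> //; apply: odd0.
Qed.

(** The doubling starts from a single odd M: there the even one of x and x - 1 vanishes by parity,
    the odd one by the choice of M. *)
Lemma binom2_half_gap (n N : nat) (x : Z2adic) :
  exists2 M, (N <= M)%N & forall k, (M <= k < M + 2 ^ n)%N ->
    binom2_half x k = 0%N /\ binom2_half (x - 1) k = 0%N.
Proof.
elim: n x => [|n IHn] x; last first.
  have [M le_NM gapM] := IHn (Z2half x); exists M.*2; first by lia.
  move=> k; rewrite expnS => /andP[le_Mk lt_kM]; rewrite (Z2_decomp x).
  by apply: binom2_half_pair0; apply: gapM; lia.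
have odd_gap y : digit y 0 -> exists2 M, (N <= M)%N & odd M /\ binom2_half y M = 0%N.
  move=> d1; have yE := Z2_decomp y; rewrite d1 in yE.
  (* M = 2j + 1 with j of parity opposite to m, so that coefficient j of Q_m is 0. *)
  set m := Z2half y in yE; exists (N.*2 + ~~ digit m 0).*2.+1; first by lia.
  split; first by lia.
  rewrite yE binom2_half_cons1 binom2_half_odd // oddD odd_double oddb addFb.
  by case: (digit m 0).
have := Z2_digit0D x (- 1); rewrite Z2_digit0N (Z2_digit0_nat 1) addbT.
case dx : (digit x 0) => dx1.
  have [M le_NM [oM x0]] := odd_gap x dx; exists M => // k; rewrite addn1 => kM.
  have -> : k = M by lia.
  by split=> //; apply: binom2_half_odd; rewrite dx1 oM.
have [M le_NM [oM x0]] := odd_gap _ dx1; exists M => // k; rewrite addn1 => kM.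
have -> : k = M by lia.
by split=> //; apply: binom2_half_odd; rewrite dx oM.
Qed.

(** If q f = p, cut f at a gap of length [size q] starting at some M >= [size p]. Below M + [size q]
    the product with q is unchanged; from there on q times the cut series and p both vanish by
    degree. *)
Lemma fps_gap_poly (K : fieldType) (f : fps K) :
  (forall n N, exists2 M, (N <= M)%N &
     forall k, (M <= k < M + n)%N -> fcoef f k = 0) ->
  fps_rational f -> fps_is_poly f.
Proof.
move=> gap /fps_rationalP[q nz_q [p qfE]].
have [M le_pM gapM] := gap (size q) (size p).
exists (fps_trunc M f); suff qrE : q * fps_trunc M f = p.
  have nz_q' : fps_of_poly q != 0 by rewrite fps_of_poly_eq0.
  by apply: (mulfI nz_q'); rewrite qfE -qrE rmorphM.
apply/polyP => i; have [lt_i|le_i] := ltnP i (M + size q).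
  rewrite -[RHS]/(fcoef (fps_of_poly p) i) -qfE coefM; apply: eq_bigr => j _ /=.
  rewrite coef_poly; case: ltnP => // le_Mk; rewrite gapM //.
  by rewrite le_Mk (leq_ltn_trans (leq_subr _ _)).
rewrite [RHS]nth_default ?(leq_trans le_pM) ?(leq_trans _ le_i) ?leq_addr //.
rewrite nth_default // (leq_trans (size_polyMleq _ _)) //.
by have := size_poly M (fcoef f); rewrite -/(fps_trunc M f); lia.
Qed.

Lemma Q2_poly_int (x : Z2adic) : fps_is_poly (Q2 x) <-> Z2_is_int x.
Proof.
split=> [[p xE]|[m ->]]; last exact: Q2_int_poly.
apply: (@binom2_half_finite_int _ (size p)) => k le_pk.
have := congr1 (fun f => fcoef f k) xE; rewrite [RHS]nth_default //=.
by have := binom2_half_le1 x k; case: (binom2_half x k) => [|[]].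
Qed.

Lemma Q2_rational_poly (x : Z2adic) : fps_rational (Q2 x) <-> fps_is_poly (Q2 x).
Proof.
split=> [|[p ->]].
  apply: fps_gap_poly => n N; have [M le_NM gapM] := binom2_half_gap n N x.
  exists M => // k /andP[le_Mk lt_kM]; rewrite /= (proj1 (gapM k _)) // le_Mk.
  by rewrite (leq_trans lt_kM) // leq_add2l ltnW // ltn_expl.
apply/fps_rationalP; exists 1; first exact: oner_neq0.
by exists p; rewrite rmorph1 mul1r.
Qed.

(** * Cartier operators on series over F_2 *)

Definition cartier (R : Type) (r : bool) (f : fps R) : fps R :=
  MkFps (fun n => fcoef f (r + n.*2)).

Lemma cartierD (R : comNzRingType) (r : bool) (f g : fps R) :
  cartier r (f + g) = cartier r f + cartier r g.
Proof. by []. Qed.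

Lemma cartier0 (R : comNzRingType) (r : bool) : cartier r (0 : fps R) = 0.
Proof. by []. Qed.

Lemma cartier_sum (R : comNzRingType) (r : bool) (I : Type) (s : seq I)
    (P : pred I) (F : I -> fps R) :
  cartier r (\sum_(i <- s | P i) F i) = \sum_(i <- s | P i) cartier r (F i).
Proof. by apply: (big_morph (cartier r)). Qed.

Lemma cartier_sqrD (f g : fps 'F_2) (r : bool) :
  cartier r (f ^+ 2 + fps_of_poly 'X * g ^+ 2) = if r then g else f.
Proof.
apply: fpsP => n; rewrite -[LHS]/(fcoef (_ + _) (r + n.*2)) fcoefD; case: r.
  by rewrite add1n fcoef_XMS fcoef_sqr_double fcoef_sqr_doubleS add0r.
rewrite add0n fcoef_sqr_double; case: n => [|n]; first by rewrite fcoef_XM0 addr0.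
by rewrite doubleS fcoef_XMS fcoef_sqr_doubleS addr0.
Qed.

Lemma cartier_decomp (f : fps 'F_2) :
  f = cartier false f ^+ 2 + fps_of_poly 'X * cartier true f ^+ 2.
Proof.
set g := RHS; have gE r : cartier r g = cartier r f by rewrite cartier_sqrD; case: r.
apply: fpsP_halves => n.
  exact: (congr1 (fun h => fcoef h n) (esym (gE false))).
exact: (congr1 (fun h => fcoef h n) (esym (gE true))).
Qed.

(** With f = f_0^2 + X f_1^2 one has f g^2 = (f_0 g)^2 + X (f_1 g)^2. *)
Lemma cartier_mul_sqr (r : bool) (f g : fps 'F_2) :
  cartier r (f * g ^+ 2) = cartier r f * g.
Proof.
rewrite {1}(cartier_decomp f) mulrDl -mulrA -!exprMn cartier_sqrD.
by case: r.
Qed.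

Definition poly_cartier (R : nzRingType) (r : bool) (p : {poly R}) : {poly R} :=
  if r then odd_poly p else even_poly p.

Lemma cartier_of_poly (R : comNzRingType) (r : bool) (p : {poly R}) :
  cartier r (fps_of_poly p) = fps_of_poly (poly_cartier r p).
Proof.
by apply: fpsP => n; case: r; rewrite /= ?coef_odd_poly ?coef_even_poly.
Qed.

Lemma size_poly_cartier (R : nzRingType) (r : bool) (p : {poly R}) (n : nat) :
  (size p <= n.*2)%N -> (size (poly_cartier r p) <= n)%N.
Proof.
move=> le_pn; rewrite /poly_cartier; have := size_odd_poly p.
by have := size_even_poly p; case: r; lia.
Qed.

Lemma poly_cartier_neq0 (R : nzRingType) (p : {poly R}) :
  p != 0 -> exists r, poly_cartier r p != 0.
Proof.
move=> nz_p; have [p0|] := eqVneq (even_poly p) 0; last by exists false.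
exists true; apply: contra_neq nz_p; rewrite /poly_cartier => p1; apply/polyP => n.
rewrite -(odd_double_half n) coef0; case: odd.
  by rewrite add1n -coef_odd_poly p1 coef0.
by rewrite add0n -coef_even_poly p0 coef0.
Qed.

(** * Algebraic series have finite Cartier orbits *)

(** Modulo a polynomial of degree d annihilating x, any d + 1 powers of the variable are linearly
    dependent. *)
Lemma algebraic_powers_lindep (F E : fieldType) (iota : {rmorphism F -> E})
    (x : E) (e : nat -> nat) :
  algebraicOver iota x ->
  exists n, exists q : {poly F},
    [/\ q != 0, (size q <= n)%N & \sum_(i < n) iota q`_i * x ^+ e i = 0].
Proof.
case=> p nz_p /rootP px0; pose d := (size p).-1.
pose A := \matrix_(i < d.+1) poly_rV ('X^(e i) %% p) : 'M_(d.+1, d).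
have [u nz_u uA0] : exists2 u : 'rV_d.+1, u != 0 & u *m A = 0.
  have /rowV0Pn[u /sub_kermxP uA0 nz_u] : kermx A != 0.
    rewrite -mxrank_eq0 mxrank_ker -lt0n subn_gt0 ltnS; exact: rank_leq_col.
  by exists u.
pose L := \sum_(i < d.+1) u 0 i *: 'X^(e i).
have Lx0 : (map_poly iota L).[x] = 0.
  suff pL : p %| L by rewrite -(divpK pL) rmorphM hornerM px0 mulr0.
  rewrite /dvdp; apply/eqP; rewrite -(@poly_rV_K _ d (L %% p)).
    rewrite -[RHS](linear0 (@rVpoly F d)) -uA0 mulmx_sum_row; congr rVpoly.
    have -> : L %% p = \sum_(i < d.+1) u 0 i *: ('X^(e i) %% p).
      rewrite /L; elim/big_rec2: _ => [|i a b _ <-]; first exact: mod0p.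
      by rewrite modpD modpZl.
    by rewrite linear_sum; apply: eq_bigr => i _; rewrite rowK linearZ.
  by rewrite -ltnS prednK ?ltn_modp ?size_poly_gt0.
exists d.+1, (rVpoly u); split; last 1 first.
- rewrite -[RHS]Lx0 rmorph_sum horner_sum; apply: eq_bigr => i _.
  by rewrite /= map_polyZ map_polyXn hornerZ hornerXn coef_rVpoly_ord.
- by apply: contra_neq nz_u => u0; rewrite -[u]rVpolyK u0 linear0.
- exact: size_poly.
Qed.

(** Exponents 2^i are chosen because f^(2^i) with i >= 1 is a square, which passes through a Cartier
    operator. *)
Lemma ore_relation (f : fps 'F_2) : fps_algebraic f ->
  exists s, exists c : nat -> {poly 'F_2}, (exists2 i, (i < s)%N & c i != 0) /\
    \sum_(i < s) fps_of_poly (c i) * f ^+ (2 ^ i) = 0.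
Proof.
move=> /(algebraic_powers_lindep (fun i => 2 ^ i)%N)[n [q [nz_q le_qn qf0]]].
have [d nz_d [p pE]] := clear_denominators q.
exists n, (fun i => p`_i); split.
  exists (size q).-1; first by rewrite prednK // size_poly_gt0.
  have : (d%:F *: q)`_(size q).-1 != 0.
    by rewrite coefZ mulf_neq0 ?tofrac_eq0 // lead_coef_eq0.
  by rewrite pE coef_map /= tofrac_eq0.
apply/eqP; rewrite -tofrac_eq0 rmorph_sum; apply/eqP.
rewrite -[RHS](mulr0 (frac_to_laurent d%:F)) -[X in _ = _ * X]qf0 big_distrr.
apply: eq_bigr => i _.
rewrite /= tofracM tofracXn -frac_to_laurent_tofrac mulrA -rmorphM.
by congr (frac_to_laurent _ * _); rewrite -coefZ pE coef_map.
Qed.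

(** If c_0 = 0, a Cartier operator lowers every exponent 2^(i+1) to 2^i and shortens the relation;
    its parity r is chosen to keep a nonzero coefficient. *)
Lemma ore_relation_separable (s : nat) (c : nat -> {poly 'F_2}) (f : fps 'F_2) :
  (exists2 i, (i < s)%N & c i != 0) ->
  \sum_(i < s) fps_of_poly (c i) * f ^+ (2 ^ i) = 0 ->
  exists s', exists2 c' : nat -> {poly 'F_2}, c' 0%N != 0 &
    \sum_(i < s'.+1) fps_of_poly (c' i) * f ^+ (2 ^ i) = 0.
Proof.
elim: s c => [|s IHs] c [i lt_is nz_ci] rel; first by [].
have [c0|nz_c0] := eqVneq (c 0%N) 0; last by exists s, c.
case: i lt_is nz_ci => [|i] lt_is nz_ci; first by rewrite c0 eqxx in nz_ci.
have [r nz_ri] := poly_cartier_neq0 nz_ci.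
apply: (IHs (fun j => poly_cartier r (c j.+1))); first by exists i.
rewrite -[RHS](cartier0 _ r) -[X in _ = cartier _ X]rel big_ord_recl.
rewrite c0 rmorph0 mul0r add0r cartier_sum.
by apply: eq_bigr => j _; rewrite /bump expnSr exprM cartier_mul_sqr cartier_of_poly.
Qed.

(* [D t h] reads: the element [t] of the finite type [T] is a code for [h]. *)
Definition finite_kernel (f : fps 'F_2) : Prop :=
  exists (T : finType) (D : T -> fps 'F_2 -> Prop),
    [/\ forall t h h', D t h -> D t h' -> h = h', exists t, D t f &
        forall t h r, D t h -> exists t', D t' (cartier r h)].

Lemma finite_kernel_cartier (r : bool) (f : fps 'F_2) :
  finite_kernel f -> finite_kernel (cartier r f).
Proof.
by case=> T [D [Dinj [t Dtf] Dstep]]; exists T, D; split=> //; apply: Dstep Dtf.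
Qed.

Lemma finite_kernel_repeat (f : fps 'F_2) : finite_kernel f ->
  exists n m, (n < m)%N /\ iter n (cartier false) f = iter m (cartier false) f.
Proof.
case=> T [D [Dinj ex_f Dstep]].
have ex_n n : exists t, D t (iter n (cartier false) f).
  by elim: n => [|n [t Dt]]; [exact: ex_f | exact: Dstep Dt].
pose code n := sval (cid (ex_n n)).
have codeP n : D (code n) (iter n (cartier false) f) := svalP (cid (ex_n n)).
have /injectivePn[i [j neq_ij eq_ij]] : ~~ injectiveb (fun i : 'I_#|T|.+1 => code i).
  by apply/negP => /injectiveP/leq_card; rewrite card_ord ltnn.
have eq_iter : iter i (cartier false) f = iter j (cartier false) f.
  by apply: (Dinj (code i)) => //; rewrite eq_ij.
move: neq_ij; rewrite -val_eqE neq_ltn => /orP[lt_ij|lt_ji].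
  by exists i, j.
by exists j, i.
Qed.

Lemma algebraic_finite_kernel (f : fps 'F_2) : fps_algebraic f -> finite_kernel f.
Proof.
case/ore_relation=> s0 [c_ [nz_c rel0]].
have [s [c nz_c0 rel]] := ore_relation_separable nz_c rel0.
pose P := @fps_of_poly 'F_2; pose C := P (c 0%N).
have nz_C : C != 0 by rewrite fps_of_poly_eq0.
(* Put f = c_0 g in the relation and divide by c_0^2. Only i >= 1 occurs there, where 2^i - 2 is not
   truncated. *)
pose d i := c i * c 0%N ^+ (2 ^ i - 2).
(* N admits c_0, hence a code for f = c_0 g. A new coefficient e_(i+1) + e_0 d_(i+1) has size at
   most 2N, which the Cartier operator halves back to N. *)
pose N := (size (c 0%N) + \sum_(i < s.+1) size (d i))%N.
have le_dN i : (i < s.+1)%N -> (size (d i) <= N)%N.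
  move=> lt_is; rewrite /N (bigD1 (Ordinal lt_is)) //=; lia.
(* With [g = f / c_0] the relation reads [g = \sum_i d_i g^(2^i)], so the set of
   all [\sum_i e_i g^(2^i)] with [e_i] of bounded degree is stable under Cartier
   operators; the powers of [C] below clear the denominators of [g]. *)
pose D (t : {ffun 'I_s.+1 -> 'rV['F_2]_N}) h :=
  C ^+ (2 ^ s.+1) * h =
  \sum_(i < s.+1) P (rVpoly (t i)) * (C ^+ (2 ^ s.+1 - 2 ^ i) * f ^+ (2 ^ i)).
exists {ffun 'I_s.+1 -> 'rV['F_2]_N}, D; split.
- by move=> t h h' Dh; rewrite /D -Dh => /(mulfI (expf_neq0 _ nz_C)).
- exists [ffun i : 'I_s.+1 => if i == ord0 then poly_rV (c 0%N) else 0].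
  rewrite /D (bigD1 ord0) //= ffunE eqxx poly_rV_K ?leq_addr // big1 => [|i /negPf nz_i].
    rewrite addr0 mulrA -exprS expn0 expr1 subn1 prednK ?expn_gt0 //.
  by rewrite ffunE nz_i linear0 /P rmorph0 mul0r.
move=> t h r Dh; pose e i := rVpoly (t (inord i)).
(* The relation turns the one non-square term e_0 g into squares; the operator then acts on
   coefficients only. *)
pose e' i := poly_cartier r (e i.+1 + e 0%N * d i.+1).
have sz_e i : (size (e i) <= N)%N by exact: size_poly.
exists [ffun i : 'I_s.+1 => if (i < s)%N then poly_rV (e' i) else 0].
have sz_e' i : (i < s)%N -> (size (e' i) <= N)%N.
  move=> lt_is; apply: size_poly_cartier; apply: (leq_trans (size_polyD _ _)).
  rewrite geq_max (leq_trans (sz_e _)) -?addnn ?leq_addr //=.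
  apply: (leq_trans (size_polyMleq _ _)); apply: (leq_trans (leq_pred _)).
  by rewrite leq_add ?sz_e ?le_dN.
have fE : C * f = \sum_(i < s) P (c i.+1) * f ^+ (2 ^ i.+1).
  apply/eqP; rewrite -subr_eq0 fps2_oppr; apply/eqP.
  by rewrite -[RHS]rel big_ord_recl expn0 expr1.
have W_sqr i : (i < s)%N -> C ^+ (2 ^ s.+1 - 2 ^ i.+1) * f ^+ (2 ^ i.+1) =
    (C ^+ (2 ^ s - 2 ^ i) * f ^+ (2 ^ i)) ^+ 2.
  by rewrite exprMn -!exprM mulnBl -!expnSr.
have CfE : C ^+ (2 ^ s.+1 - 1) * f =
    \sum_(i < s) P (d i.+1) * (C ^+ (2 ^ s - 2 ^ i) * f ^+ (2 ^ i)) ^+ 2.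
  have -> : (2 ^ s.+1 - 1 = (2 ^ s.+1 - 2).+1)%N.
    by have := expn_gt0 2 s; rewrite expnS; lia.
  rewrite exprSr -mulrA fE big_distrr; apply: eq_bigr => i _ /=.
  rewrite -W_sqr // /P rmorphM rmorphXn -/P -/C mulrCA -!mulrA; congr (_ * _).
  rewrite mulrA -exprD; congr (C ^+ _ * _).
  have : (2 ^ i <= 2 ^ s)%N by rewrite leq_exp2l // ltnW.
  by have := expn_gt0 2 i; rewrite !expnS; lia.
have DhE : C ^+ (2 ^ s.+1) * h = \sum_(i < s) P (e i.+1 + e 0%N * d i.+1) *
    (C ^+ (2 ^ s - 2 ^ i) * f ^+ (2 ^ i)) ^+ 2.
  have eE (i : 'I_s.+1) : rVpoly (t i) = e i by rewrite /e inord_val.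
  rewrite Dh big_ord_recl eE /= expn0 expr1 CfE big_distrr -big_split.
  apply: eq_bigr => i _; rewrite eE /= /bump add1n W_sqr //.
  rewrite mulrA -mulrDl addrC; congr (_ * _).
  by rewrite [RHS]rmorphD; congr (_ + _); apply/esym/rmorphM.
have DhE' := congr1 (cartier r) DhE.
(* The factor C^(2^(s+1)) is a square and comes out as C^(2^s); the lost factor C^(2^s) is
   multiplied back below. *)
rewrite cartier_sum expnSr exprM mulrC cartier_mul_sqr in DhE'.
rewrite /D expnS mul2n -addnn exprD -mulrA [_ * cartier r h]mulrC DhE' big_distrr /=.
rewrite [RHS]big_ord_recr /= ffunE ltnn linear0 /P rmorph0 mul0r addr0.
apply: eq_bigr => i _; rewrite ffunE /= ltn_ord poly_rV_K ?sz_e' //.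
rewrite cartier_mul_sqr cartier_of_poly mulrCA; congr (_ * _).
rewrite mulrA -exprD; congr (C ^+ _ * _).
have : (2 ^ i <= 2 ^ s)%N by rewrite leq_exp2l // ltnW.
by lia.
Qed.

(** * Eventually periodic digits, and rationality of w *)

Lemma digit_iter_half (x : Z2adic) (n i : nat) :
  digit (iter n Z2half x) i = digit x (n + i).
Proof. by elim: n i => // n IHn i; rewrite iterS /= -/(digit _ _) IHn addnS. Qed.

Lemma Z2_iter_halfE (x : Z2adic) (n : nat) :
  x = 2%:R ^+ n * iter n Z2half x + (trunc x n)%:R.
Proof.
elim: n => [|n IHn]; first by rewrite mul1r /trunc big_ord0 addr0.
rewrite {1}IHn truncS iterS {1}(Z2_decomp (iter n Z2half x)).
rewrite digit_iter_half addn0 natrD natrM natrX exprSr; ring.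
Qed.

(** The tail z after N digits satisfies (1 - 2^P) z = [trunc z P], as for a geometric series, and x
    = 2^N z + [trunc x N]. *)
Lemma Z2_is_rat_periodic (x : Z2adic) (N P : nat) : (0 < P)%N ->
  (forall i, (N <= i)%N -> digit x (i + P) = digit x i) -> Z2_is_rat x.
Proof.
move=> P_gt0 per; pose z := iter N Z2half x.
have zE : z = 2%:R ^+ P * z + (trunc z P)%:R.
  rewrite {1}(Z2_iter_halfE z P); congr (_ * _ + _).
  apply: trunc_inj => n; apply: eq_bigr => i _.
  by rewrite !digit_iter_half addnCA addnC per ?leq_addr.
have xE := Z2_iter_halfE x N; rewrite -/z in xE.
exists ((2 ^ N)%:Z * (trunc z P)%:Z + (1 - (2 ^ P)%:Z) * (trunc x N)%:Z).
exists (1 - (2 ^ P)%:Z); split.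
  by have := ltn_expl P (isT : (1 < 2)%N); lia.
rewrite !(intrD, intrM, mulrNz) -!pmulrn !natrX.
rewrite {1}xE mulrDr; congr (_ + _).
have <- : z - 2%:R ^+ P * z = (trunc z P)%:R by rewrite {1}zE addrAC subrr add0r.
by ring.
Qed.

Definition Q2_pair (x : Z2adic) : fps 'F_2 := Q2 x + Q2 (x - 1).

Lemma cartier0_Q2_cons0 (x : Z2adic) :
  cartier false (Q2 (2%:R * x)) = Q2_pair x.
Proof.
rewrite Q2_cons0 cartierD -[Q2 x ^+ 2]mul1r -[Q2 (x - 1) ^+ 2]mul1r.
rewrite !cartier_mul_sqr (_ : cartier false 1 = 1) ?mul1r //.
by apply: fpsP => -[].
Qed.

Lemma cartier_Q2_cons1 (x : Z2adic) (r : bool) :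
  cartier r (Q2 (2%:R * x + 1)) = if r then Q2 x else 0.
Proof.
have := cartier_sqrD 0 (Q2 x) r; rewrite expr0n add0r -Q2_cons1 => ->.
by case: r.
Qed.

(** The even operator kills the series of the odd one of x, x - 1 and sends that of the even one,
    2j, to Q_j + Q_(j-1), where j is [Z2half x] in both cases. *)
Lemma cartier0_Q2_pair (x : Z2adic) :
  cartier false (Q2_pair x) = Q2_pair (Z2half x).
Proof.
rewrite {1}(Z2_decomp x); set m := Z2half x; rewrite {1}/Q2_pair cartierD.
case: (digit x 0).
  by rewrite addrK cartier_Q2_cons1 add0r cartier0_Q2_cons0.
rewrite addr0 cartier0_Q2_cons0 (_ : _ - 1 = 2%:R * (m - 1) + 1); last by ring.
by rewrite cartier_Q2_cons1 addr0.
Qed.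

(** This coefficient lets digits be read off: it compares two neighbouring ones. *)
Lemma Q2_pair_at1 (x : Z2adic) :
  fcoef (Q2_pair x) 1 = (digit x 0 (+) digit x 1)%:R.
Proof.
have Q2_even1 y : fcoef (Q2 (2%:R * y)) 1 = 0.
  by rewrite Q2_cons0 fcoefD !fcoef_sqr addr0.
have Q2_odd1 y : fcoef (Q2 (2%:R * y + 1)) 1 = (~~ digit y 0)%:R.
  by rewrite Q2_cons1 fcoef_XMS fcoef_sqr Q2_at0.
rewrite -[digit x 1]/(digit (Z2half x) 0) {1}(Z2_decomp x); set m := Z2half x.
rewrite /Q2_pair fcoefD; case: (digit x 0).
  by rewrite addrK Q2_odd1 Q2_even1 addr0.
rewrite addr0 Q2_even1 (_ : _ - 1 = 2%:R * (m - 1) + 1); last by ring.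
by rewrite Q2_odd1 add0r Z2_digit0D Z2_digit0N (Z2_digit0_nat 1) addbT negbK.
Qed.

(** The odd operator strips leading digits 1; at the first digit 0 the even operator produces the
    pair. *)
Lemma finite_kernel_Q2_pair (x : Z2adic) (j : nat) :
  finite_kernel (Q2 x) -> digit x j = false ->
  exists n, finite_kernel (Q2_pair (iter n Z2half x)).
Proof.
elim: j x => [|j IHj] x fin_x xj; have xE := Z2_decomp x.
  exists 1; move: (finite_kernel_cartier false fin_x).
  by rewrite {1}xE xj addr0 cartier0_Q2_cons0.
move: (finite_kernel_cartier (digit x 0) fin_x); rewrite {2}xE.
case d0 : (digit x 0).
  rewrite cartier_Q2_cons1 => /IHj[//|n fin_n]; exists n.+1; rewrite iterSr //.
by rewrite addr0 cartier0_Q2_cons0; exists 1.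
Qed.

Lemma Q2_algebraic_rat (x : Z2adic) : fps_algebraic (Q2 x) -> Z2_is_rat x.
Proof.
move=> /algebraic_finite_kernel fin_x.
have [allT|[j xj]] : (forall j, digit x j) \/ exists j, digit x j = false.
  have [?|/existsNP[j /negP/negPf ?]] := pselect (forall j, digit x j); [by left|].
  by right; exists j.
  by apply: (@Z2_is_rat_periodic x 0 1) => // i _; rewrite !allT.
have [k fin_k] := finite_kernel_Q2_pair fin_x xj; have [y yE fin_y] :
  exists2 y, forall i, digit y i = digit x (k + i) & finite_kernel (Q2_pair y).
  by exists (iter k Z2half x) => // i; rewrite digit_iter_half.
have [n [m [lt_nm eq_nm]]] := finite_kernel_repeat fin_y.
have iterE i : iter i (cartier false) (Q2_pair y) = Q2_pair (iter i Z2half y).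
  by elim: i => // i IHi; rewrite !iterS IHi cartier0_Q2_pair.
have xorE i : digit y (n + i) (+) digit y (n + i.+1) =
              digit y (m + i) (+) digit y (m + i.+1).
  have : iter (i + n) (cartier false) (Q2_pair y) =
    iter (i + m) (cartier false) (Q2_pair y) by rewrite !iterD eq_nm.
  rewrite !iterE => /(congr1 (fun f => fcoef f 1)); rewrite !Q2_pair_at1.
  rewrite ![digit (iter _ Z2half y) _]digit_iter_half !addn0 !addn1.
  rewrite ![(i + _)%N]addnC -!addnS.
  by case: (_ (+) _); case: (_ (+) _).
pose p := (m - n)%N.
(* Neighbouring comparisons agree after the shift by p, so this shift changes all digits from n on
   by one constant bit; applied twice it is the identity, whence the period 2p. *)
have delta i : digit y (n + i) (+) digit y (n + i + p) =
    digit y n (+) digit y (n + p).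
  elim: i => [|i IHi]; first by rewrite addn0.
  rewrite -IHi; have := xorE i; rewrite (_ : m + i = n + i + p)%N; last by lia.
  rewrite (_ : m + i.+1 = n + i.+1 + p)%N; last by lia.
  by do 4!case: (digit y _).
apply: (@Z2_is_rat_periodic x (k + n) (p + p)); first by lia.
move=> i le_i; pose l := (i - (k + n))%N.
have -> : i = (k + (n + l))%N by lia.
rewrite -addnA -!yE addnA.
have := delta (l + p)%N; rewrite -(delta l) addnA.
by do 3!case: (digit y _).
Qed.

(** * The l1 norm of integer polynomials, as a bound on the unit disc *)

Definition norm1 (p : {poly int}) : nat := (\sum_(i < size p) absz (p`_i)%R)%N.

Lemma norm1_wide (p : {poly int}) (n : nat) :
  (size p <= n)%N -> norm1 p = (\sum_(i < n) absz (p`_i)%R)%N.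
Proof.
move=> le_pn; rewrite -(subnKC le_pn) big_split_ord /=.
rewrite [X in (_ + X)%N]big1 ?addn0 // => i _.
by rewrite nth_default ?leq_addr.
Qed.

Lemma norm1D (p q : {poly int}) : (norm1 (p + q)%R <= norm1 p + norm1 q)%N.
Proof.
pose n := maxn (size p) (size q).
rewrite (@norm1_wide (p + q) n) ?size_polyD // (@norm1_wide p n) ?leq_maxl //.
rewrite (@norm1_wide q n) ?leq_maxr // -big_split; apply: leq_sum => i _.
by rewrite coefD /=; move: (p`_i) (q`_i) => a b; lia.
Qed.

Lemma norm1_cons (p : {poly int}) (c : int) :
  norm1 (p * 'X + c%:P) = (`|c| + norm1 p)%N.
Proof.
have sz : (size (p * 'X + c%:P)%R <= (size p).+1)%N.
  by rewrite size_MXaddC; case: ifP.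
rewrite (norm1_wide sz) big_ord_recl coefD coefMX coefC /= add0r; congr (_ + _)%N.
by apply: eq_bigr => i _; rewrite coefD coefMX coefC /= addr0.
Qed.

Lemma norm1_0 : norm1 0 = 0%N.
Proof. by rewrite /norm1 size_poly0 big_ord0. Qed.

Lemma norm1M (p q : {poly int}) : (norm1 (p * q)%R <= norm1 p * norm1 q)%N.
Proof.
elim/poly_ind: p => [|p c IHp]; first by rewrite mul0r norm1_0.
have cqE : norm1 (c%:P * q) = (`|c| * norm1 q)%N.
  rewrite mul_polyC (@norm1_wide _ (size q)) ?size_scale_leq // big_distrr.
  by apply: eq_bigr => i _; rewrite coefZ abszM.
have pqE : norm1 (p * q * 'X) = norm1 (p * q).
  by have := norm1_cons (p * q) 0; rewrite addr0.
rewrite norm1_cons mulrDl mulrAC (leq_trans (norm1D _ _)) // pqE cqE.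
by rewrite mulnDl addnC leq_add2l.
Qed.

Lemma norm1X (p : {poly int}) (n : nat) : (norm1 (p ^+ n)%R <= norm1 p ^ n)%N.
Proof.
elim: n => [|n IHn].
  by rewrite expr0 /norm1 size_poly1 big_ord1 coef1.
by rewrite exprS expnS (leq_trans (norm1M _ _)) // leq_mul2l IHn orbT.
Qed.

Lemma norm1_sum (I : Type) (s : seq I) (F : I -> {poly int}) :
  (norm1 (\sum_(i <- s) F i)%R <= \sum_(i <- s) norm1 (F i))%N.
Proof.
elim/big_rec2: _ => [|i m p _ le_pm]; first by rewrite norm1_0.
by rewrite (leq_trans (norm1D _ _)) // leq_add2l.
Qed.

Lemma norm1_gt0 (p : {poly int}) : p != 0 -> (0 < norm1 p)%N.
Proof.
move=> nz_p; have lt_p : ((size p).-1 < size p)%N by rewrite prednK ?size_poly_gt0.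
rewrite /norm1 (bigD1 (Ordinal lt_p)) //= ltn_addr // absz_gt0.
by rewrite -lead_coefE lead_coef_eq0.
Qed.

Local Notation polyZtoC := (map_poly (intr : int -> algC)).

Lemma horner_norm1 (p : {poly int}) (N : nat) (z : algC) :
  `|z| <= 1 -> (forall i, (i < N)%N -> p`_i = 0) ->
  `|(polyZtoC p).[z]| <= (norm1 p)%:R * `|z| ^+ N.
Proof.
move=> le_z1 p0; rewrite (@horner_coef_wide _ (size p)); last first.
  by rewrite size_map_inj_poly //; exact: intr_inj.
rewrite (le_trans (ler_norm_sum _ _ _)) // /norm1 natr_sum big_distrl.
apply: ler_sum => i _; rewrite coef_map normrM normrX /= -intr_norm.
rewrite -[`|p`_i|%R]/((absz p`_i)%:Z) -pmulrn.
have [lt_iN|le_Ni] := ltnP i N; first by rewrite p0 // !mul0r.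
by rewrite ler_wpM2l // ler_wiXn2l.
Qed.

Lemma horner_norm1_le (p : {poly int}) (z : algC) :
  `|z| <= 1 -> `|(polyZtoC p).[z]| <= (norm1 p)%:R.
Proof.
move=> le_z1; rewrite -[leRHS]mulr1 -(expr0 `|z|).
exact: horner_norm1.
Qed.

(** * Discrete Parseval identity *)

Lemma prim_root_sum_eq0 (F : fieldType) (n : nat) (x : F) :
  x ^+ n = 1 -> x != 1 -> \sum_(j < n) x ^+ j = 0.
Proof.
move=> xn1 x1; apply/eqP; have /eqP := subrX1 x n.
by rewrite xn1 subrr eq_sym mulf_eq0 subr_eq0 (negPf x1).
Qed.

(** Expand the squares and use orthogonality of the characters j -> zeta^(ij). Sampling at roots of
    unity stands for integration over a circle. *)
Lemma parseval (n : nat) (g : nat -> algC) (zeta : algC) :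
  (0 < n)%N -> n.-primitive_root zeta ->
  \sum_(j < n) `|\sum_(i < n) g i * (zeta ^+ j) ^+ i| ^+ 2 =
  n%:R * \sum_(i < n) `|g i| ^+ 2.
Proof.
move=> n_gt0 prim; have norm_zeta : `|zeta| = 1.
  apply/eqP; rewrite -(@pexpr_eq1 _ _ n) ?normr_ge0 // -normrX.
  by rewrite (prim_expr_order prim) normr1.
have nz_zeta : zeta != 0 by rewrite -normr_eq0 norm_zeta oner_eq0.
have conj_zeta k : (zeta ^+ k)^* = (zeta ^+ k)^-1.
  by rewrite invC_norm normrX norm_zeta !expr1n invr1 mul1r.
transitivity (\sum_(j < n) \sum_(i < n) \sum_(k < n)
    g i * (g k)^* * (zeta ^+ i / zeta ^+ k) ^+ j).
  apply: eq_bigr => j _; rewrite normCK rmorph_sum big_distrl; apply: eq_bigr => i _.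
  rewrite big_distrr; apply: eq_bigr => k _ /=.
  rewrite rmorphM /= mulrACA -!exprM conj_zeta expr_div_n -!exprM; congr (_ * (_ / _)).
    by rewrite mulnC.
  by rewrite mulnC.
rewrite exchange_big big_distrr; apply: eq_bigr => i _ /=.
rewrite exchange_big (bigD1 i) //= [X in _ + X]big1 => [|k ne_ki].
  rewrite addr0 -big_distrr /= normCK mulrC; congr (_ * _).
  rewrite divff ?expf_neq0 //; under eq_bigr do rewrite expr1n.
  by rewrite sumr_const card_ord.
rewrite -big_distrr /= prim_root_sum_eq0 ?mulr0 //.
  rewrite expr_div_n -!exprM ![(_ * n)%N]mulnC !exprM.
  by rewrite (prim_expr_order prim) !expr1n divr1.
rewrite -subr_eq0 -(mulVf (expf_neq0 k nz_zeta)) mulrC -mulrBr.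
rewrite mulf_neq0 ?invr_eq0 ?expf_neq0 // subr_eq0 (eq_prim_root_expr prim).
by rewrite !modn_small // eq_sym.
Qed.

(** * From relations over Q(X) to relations over Z[X] *)

Lemma map_fps_is_zmod_morphism (R S : comNzRingType) (h : {rmorphism R -> S}) :
  zmod_morphism (map_fps h).
Proof. by move=> f g; apply: fpsP => n; rewrite /= rmorphB. Qed.

Lemma map_fps_is_monoid_morphism (R S : comNzRingType) (h : {rmorphism R -> S}) :
  monoid_morphism (map_fps h).
Proof.
split=> [|f g]; apply: fpsP => n; first by rewrite /= rmorph_nat.
by rewrite /= rmorph_sum; apply: eq_bigr => i _; rewrite rmorphM.
Qed.

HB.instance Definition _ (R S : comNzRingType) (h : {rmorphism R -> S}) :=
  GRing.isZmodMorphism.Build (fps R) (fps S) (map_fps h) (map_fps_is_zmod_morphism h).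
HB.instance Definition _ (R S : comNzRingType) (h : {rmorphism R -> S}) :=
  GRing.isMonoidMorphism.Build (fps R) (fps S) (map_fps h) (map_fps_is_monoid_morphism h).

Lemma map_fps_of_poly (R S : comNzRingType) (h : {rmorphism R -> S}) (p : {poly R}) :
  map_fps h (fps_of_poly p) = fps_of_poly (map_poly h p).
Proof. by apply: fpsP => n; rewrite /= coef_map. Qed.

Lemma clear_rat_denominators (P : {poly {poly rat}}) :
  exists2 d : int, d != 0 & exists Q : {poly {poly int}},
    (d%:~R : rat)%:P *: P = map_poly (map_poly (intr : int -> rat)) Q.
Proof.
elim/poly_ind: P => [|P p [d nz_d [Q dPE]]].
  by exists 1 => //; exists 0; rewrite scaler0 rmorph0.
have [q [a nz_a pE]] := rat_poly_scale p.
exists (a * d); first exact: mulf_neq0.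
exists (a%:P *: Q * 'X + (d%:P * q)%:P).
have mapC c r : map_poly (intr : int -> rat) (c%:P * r) =
    (c%:~R)%:P * map_poly (intr : int -> rat) r.
  by rewrite rmorphM; congr (_ * _); exact: map_polyC.
apply/polyP => i; rewrite coef_map_id0 ?rmorph0 // coefZ !coefD !coefMX !coefC coefZ.
case: i => [|i] /=; rewrite ?add0r ?addr0 mapC.
  by rewrite pE -mul_polyC mulrA -polyCM intrM mulrAC mulfV ?intr_eq0 // mul1r.
rewrite intrM polyCM -mulrA; congr (_ * _).
by rewrite -coefZ dPE coef_map_id0 ?rmorph0.
Qed.

Lemma fps_algebraic_int (f : fps int) :
  fps_algebraic (map_fps (intr : int -> rat) f) ->
  exists2 Q : {poly {poly int}}, Q != 0 &
    \sum_(i < size Q) fps_of_poly Q`_i * f ^+ i = 0.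
Proof.
case/fps_algebraicP=> P nz_P Pf0; have [d nz_d [Q dPE]] := clear_rat_denominators P.
exists Q.
  apply: contra_neq nz_P => Q0; move/eqP: dPE.
  rewrite Q0 map_poly0 -mul_polyC mulf_eq0 !polyC_eq0 intr_eq0 (negPf nz_d).
  by move/eqP.
have inj : injective (map_fps (intr : int -> rat)).
  move=> g h gh; apply: fpsP => n; apply: (@intr_inj rat).
  exact: (congr1 (fun k => fcoef k n) gh).
apply: inj; rewrite rmorph0 rmorph_sum.
transitivity ((map_poly (@fps_of_poly rat) ((d%:~R : rat)%:P *: P)).[
  map_fps (intr : int -> rat) f]).
  rewrite dPE -map_poly_comp (@horner_coef_wide _ (size Q)).
    apply: eq_bigr => i _; rewrite rmorphM rmorphXn coef_map_id0 /=.
      by rewrite map_fps_of_poly.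
    by rewrite !rmorph0.
  exact: size_poly.
by rewrite map_polyZ hornerZ Pf0 mulr0.
Qed.

(** * Fatou's argument: bounded integer coefficients and algebraicity give rationality *)

(** Bernoulli's inequality (1 - 1/(m+1))^n >= 1 - n/(m+1), cleared of denominators. *)
Lemma bernoulli_nat_lower (m n : nat) :
  (m.+1 ^ n.+1 <= m ^ n * m.+1 + n * m.+1 ^ n)%N.
Proof. by elim: n => [|n IHn]; [lia | move: IHn; rewrite !expnS; nia]. Qed.

(** Likewise (1 + 1/m)^n >= 1 + n/m. *)
Lemma bernoulli_nat_upper (m n : nat) : (m ^ n * (m + n) <= m.+1 ^ n * m)%N.
Proof. by elim: n => [|n IHn]; [lia | move: IHn; rewrite !expnS; nia]. Qed.

Lemma leq_expM2r (a b e : nat) : (a <= b)%N -> (a ^ e <= b ^ e)%N.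
Proof. by move=> le_ab; elim: e => // e IHe; rewrite !expnS leq_mul. Qed.

Lemma exists_geometric_le (m D B d K : nat) : (0 < m)%N ->
  exists2 N, (K <= N)%N & (D * (N * B + 1) ^ d * m ^ N <= m.+1 ^ N)%N.
Proof.
(* As (1 + 1/m)^m >= 2, this N gives (1 + 1/m)^N >= 2^((d+1)u), while the polynomial factor is at
   most D E^d (u+1)^d <= (u+1)^(d+1), because u >= D E^d. *)
move=> m_gt0; pose E := (m * d.+1 * B + 1)%N; pose u := (K + D * E ^ d)%N.
exists (m * (d.+1 * u))%N; first by rewrite /u; nia.
have two_pow : (2 * m ^ m <= m.+1 ^ m)%N.
  by have := bernoulli_nat_upper m m; rewrite -(leq_pmul2r m_gt0); nia.
have poly_le : (D * (m * (d.+1 * u) * B + 1) ^ d <= 2 ^ (d.+1 * u))%N.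
  have base_le : (m * (d.+1 * u) * B + 1 <= E * u.+1)%N by rewrite /E; nia.
  apply: (@leq_trans (D * (E * u.+1) ^ d)).
    by rewrite leq_mul2l leq_expM2r ?orbT.
  rewrite expnMn mulnA (@leq_trans (u.+1 * u.+1 ^ d)) ?leq_mul2r ?/u //.
    by rewrite orbC -/u leqW // leq_addl.
  by rewrite -expnS [(d.+1 * u)%N]mulnC expnM leq_exp2r // ltn_expl.
rewrite !(expnM _ m) (@leq_trans (2 ^ (d.+1 * u) * (m ^ m) ^ (d.+1 * u))) //.
  by rewrite leq_mul2r poly_le orbT.
by rewrite -expnMn leq_expM2r.
Qed.

Lemma bounded_count_finite (p : pred nat) (M : nat) :
  (forall K, (\sum_(i < K) p i <= M)%N) -> exists n, forall i, (n <= i)%N -> ~~ p i.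
Proof.
move=> bnd; pose c K := (\sum_(i < K) p i)%N.
have ex_c : exists v, `[< exists K, c K = v >] by exists (c 0%N); apply/asboolP; exists 0%N.
have c_le v : `[< exists K, c K = v >] -> (v <= M)%N.
  by move=> /asboolP[K <-]; exact: bnd.
case: (ex_maxnP ex_c c_le) => v /asboolP[n cn] max_v.
exists n => i le_ni; apply/negP => pi.
have c_mono : (c n <= c i)%N.
  rewrite -(subnKC le_ni); elim: (i - n)%N => [|k IHk]; first by rewrite addn0.
  by rewrite addnS /c big_ord_recr /= (leq_trans IHk) // leq_addr.
have cS : c i.+1 = (c i).+1 by rewrite /c big_ord_recr /= pi addn1.
have : (c i.+1 <= v)%N by apply: max_v; apply/asboolP; exists i.+1.
by rewrite cS -cn ltnNge c_mono.
Qed.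

(* Multiplying the relation of degree [d] for [y] by [a^(d-1)] gives a monic
   relation for [a * y]. *)
Lemma horner_leading_bound (Q : {poly {poly int}}) (d : nat) (z y : algC) :
  size Q = d.+1 -> (0 < d)%N -> `|z| <= 1 ->
  `|\sum_(i < d.+1) (polyZtoC Q`_i).[z] * y ^+ i| <= 1 ->
  `|(polyZtoC Q`_d).[z] * y| <=
    ((1 + \sum_(i < d) norm1 Q`_i) * norm1 Q`_d ^ d)%:R.
Proof.
move=> szQ d_gt0 le_z1; set R := \sum_(i < d.+1) _ => le_R1.
pose P i := (polyZtoC Q`_i).[z]; pose w := P d * y; pose A := norm1 Q`_d.
have A_gt0 : (0 < A)%N.
  apply: norm1_gt0; rewrite -[d]/(d.+1.-1) -szQ -lead_coefE lead_coef_eq0.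
  by rewrite -size_poly_gt0 szQ.
rewrite -/(P d) -/w -/A; set C := (_ * _)%N.
have C_gt0 : (0 < C)%N by rewrite /C muln_gt0 expn_gt0 A_gt0.
(* For |w| < 1 the bound is immediate; otherwise the monic relation is divided by |w|^(d-1). *)
have [lt_w1|le_1w] := real_ltP (normr_real w) (real1 _).
  by rewrite (le_trans (ltW lt_w1)) // ler1n.
pose S := \sum_(i < d) P i * (P d ^+ (d.-1 - i) * w ^+ i).
have wdE : w ^+ d = P d ^+ d.-1 * R - S.
  have <- : P d ^+ d.-1 * (\sum_(i < d) P i * y ^+ i) = S.
    rewrite mulr_sumr; apply: eq_bigr => i _.
    rewrite mulrCA; congr (_ * _); rewrite exprMn mulrA -exprD subnK //.
    by have := ltn_ord i; lia.
  rewrite /R big_ord_recr /= -/(P d) mulrDr [_ * (P d * _)]mulrA -exprSr.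
  by rewrite prednK // -exprMn addrC addKr.
have Pd_le k : (k <= d)%N -> `|P d ^+ k| <= (A ^ d)%:R.
  move=> le_kd; rewrite normrX natrX (@le_trans _ _ (A%:R ^+ k)) //.
    by rewrite lerXn2r ?nnegrE ?normr_ge0 ?ler0n // horner_norm1_le.
  by rewrite ler_weXn2l // ler1n.
have w_gt0 : 0 < `|w| := lt_le_trans ltr01 le_1w.
rewrite -(ler_pM2r (exprn_gt0 d.-1 w_gt0)) -exprS prednK // -normrX wdE.
rewrite (le_trans (ler_normB _ _)) // /C natrM natrD mulrDl mul1r mulrDl lerD //.
  rewrite normrM ler_pM ?normr_ge0 ?Pd_le ?leq_pred //.
  by rewrite (le_trans le_R1) // exprn_ege1.
rewrite (le_trans (ler_norm_sum _ _ _)) // natr_sum -mulrA big_distrl /=.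
apply: ler_sum => i _; rewrite normrM ler_pM ?normr_ge0 ?horner_norm1_le //.
rewrite normrM ler_pM ?normr_ge0 ?Pd_le //; first by lia.
by rewrite normrX ler_weXn2l //; have := ltn_ord i; lia.
Qed.

Definition fps_eqmod (R : Type) (N : nat) (f g : fps R) : Prop :=
  forall i, (i < N)%N -> fcoef f i = fcoef g i.

Lemma fps_eqmodM (R : comNzRingType) (N : nat) (f f' g g' : fps R) :
  fps_eqmod N f f' -> fps_eqmod N g g' -> fps_eqmod N (f * g) (f' * g').
Proof.
move=> ff gg i lt_iN; apply: eq_bigr => j _; have := ltn_ord j => lt_j.
by rewrite ff ?gg //; lia.
Qed.

Lemma fps_eqmodX (R : comNzRingType) (N n : nat) (f f' : fps R) :
  fps_eqmod N f f' -> fps_eqmod N (f ^+ n) (f' ^+ n).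
Proof.
by move=> ff; elim: n => // n IHn; rewrite !exprS; apply: fps_eqmodM.
Qed.

Lemma bounded_algebraic_rational (f : fps int) (B : nat) :
  (forall i, (absz (fcoef f i) <= B)%N) ->
  fps_algebraic (map_fps (intr : int -> rat) f) ->
  exists2 a : {poly int}, a != 0 &
    exists b : {poly int}, fps_of_poly a * f = fps_of_poly b.
Proof.
move=> f_le /fps_algebraic_int[Q nz_Q Qf0].
have [d szQ] : exists d, size Q = d.+1.
  by exists (size Q).-1; rewrite prednK ?size_poly_gt0.
have nz_a : Q`_d != 0 by rewrite -[d]/(d.+1.-1) -szQ -lead_coefE lead_coef_eq0.
exists Q`_d => //; rewrite szQ in Qf0.
have d_gt0 : (0 < d)%N.
  rewrite lt0n; apply/negP => /eqP d0; subst d; case/negP: nz_a.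
  by rewrite -fps_of_poly_eq0 -[X in _ == X]Qf0 big_ord1 mulr1.
pose a := Q`_d; pose g := fps_of_poly a * f; rewrite -/a -/g.
pose C := ((1 + \sum_(i < d) norm1 Q`_i) * norm1 a ^ d)%N.
pose D := (\sum_(i < d.+1) norm1 Q`_i)%N.
(* A bound independent of K on the number of nonzero coefficients below K makes g a polynomial. *)
suff g_count K : (\sum_(i < K) (fcoef g i != 0) <= 2 * C ^ 2)%N.
  have [n g0] := @bounded_count_finite (fun i => fcoef g i != 0) _ g_count.
  exists (fps_trunc n g); apply: fpsP => i /=; rewrite coef_poly.
  by case: ltnP => // /g0; rewrite negbK => /eqP.
(* The radius r = m/(m+1) is so close to 1 that r^(2K) >= 1/2. *)
pose m := (4 * K).+1; have m_gt0 : (0 < m)%N by [].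
(* The relation evaluated at the truncation F vanishes to order N, and its norm grows polynomially
   in N; for this N it is at most 1 on |z| = r. *)
have [N le_KN N_le] := exists_geometric_le D B d K m_gt0.
pose F := fps_trunc N f; pose R := \sum_(i < d.+1) Q`_i * F ^+ i.
have Ff : fps_eqmod N (fps_of_poly F) f.
  by move=> i lt_iN; rewrite /= coef_fps_trunc.
have R0 i : (i < N)%N -> R`_i = 0.
  move=> lt_iN; rewrite -[LHS]/(fcoef (fps_of_poly R) i).
  rewrite -[RHS]/(fcoef (0 : fps int) i) -Qf0 rmorph_sum !fcoef_sum.
  apply: eq_bigr => j _; rewrite rmorphM rmorphXn.
  by apply: fps_eqmodM lt_iN => //; apply: fps_eqmodX.
have norm_F : (norm1 F <= N * B)%N.
  rewrite (@norm1_wide F N) ?size_poly // -[N in (N * _)%N]card_ord -sum_nat_const.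
  by apply: leq_sum => i _; rewrite coef_fps_trunc.
have norm_R : (norm1 R <= D * (N * B + 1) ^ d)%N.
  rewrite (leq_trans (norm1_sum _ _)) // /D big_distrl; apply: leq_sum => i _.
  rewrite (leq_trans (norm1M _ _)) // leq_mul // (leq_trans (norm1X _ _)) //.
  rewrite (@leq_trans ((N * B + 1) ^ i)) ?leq_expM2r ?(leq_trans norm_F) ?leq_addr //.
  by rewrite leq_pexp2l ?addn1 // -ltnS.
pose r : algC := m%:R / m.+1%:R.
have r_ge0 : 0 <= r by rewrite divr_ge0 ?ler0n.
have r_le1 : r <= 1 by rewrite ler_pdivrMr ?ltr0n // mul1r ler_nat.
have aF_le z : `|z| = r -> `|(polyZtoC (a * F)).[z]| <= C%:R.
  move=> zr; have le_z1 : `|z| <= 1 by rewrite zr.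
  rewrite rmorphM hornerM; apply: horner_leading_bound => //.
  have -> : \sum_(i < d.+1) (polyZtoC Q`_i).[z] * (polyZtoC F).[z] ^+ i =
      (polyZtoC R).[z].
    rewrite rmorph_sum horner_sum; apply: eq_bigr => i _.
    by rewrite rmorphM rmorphXn hornerM horner_exp.
  rewrite (le_trans (horner_norm1 le_z1 R0)) // zr expr_div_n mulrA.
  rewrite ler_pdivrMr ?exprn_gt0 ?ltr0n // mul1r -!natrX -natrM ler_nat.
  by rewrite (leq_trans _ N_le) // leq_mul2r norm_R orbT.
(* More sample points than the degree of a F, so that Parseval sees every coefficient. *)
pose n := (size (a * F) + N).+1.
have [zeta prim] := C_prim_root_exists (ltn0Sn (size (a * F) + N) : (0 < n)%N).
have norm_zeta : `|zeta| = 1.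
  apply/eqP; rewrite -(@pexpr_eq1 _ _ n) ?normr_ge0 // -normrX.
  by rewrite (prim_expr_order prim) normr1.
have := parseval (fun i => (polyZtoC (a * F))`_i * r ^+ i) (ltn0Sn _) prim.
rewrite -/n => parsE.
have sz_map : (size (polyZtoC (a * F)) <= size (a * F)%R)%N.
  by rewrite size_map_inj_poly //; exact: intr_inj.
have sum_le : \sum_(i < n) `|(polyZtoC (a * F))`_i * r ^+ i| ^+ 2 <= C%:R ^+ 2.
  rewrite -(ler_pM2l (_ : 0 < n%:R)) ?ltr0n // -parsE.
  rewrite mulr_natl -[X in _ *+ X]card_ord -sumr_const; apply: ler_sum => j _.
  rewrite lerXn2r ?nnegrE ?normr_ge0 ?ler0n //.
  rewrite (_ : \sum_(i < n) _ = (polyZtoC (a * F)).[r * zeta ^+ j]).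
    by apply: aF_le; rewrite normrM normrX norm_zeta expr1n mulr1 ger0_norm.
  rewrite (@horner_coef_wide _ n).
    apply: eq_bigr => i _; rewrite [in RHS]exprMn [RHS]mulrA; congr (_ * _ * _).
  by apply: (leq_trans sz_map); rewrite /n leqW // leq_addr.
have aF_coef i : (i < K)%N -> (a * F)`_i = fcoef g i.
  move=> lt_iK; rewrite -[LHS]/(fcoef (fps_of_poly (a * F)) i) rmorphM.
  by apply: (fps_eqmodM _ Ff) => //; apply: leq_trans le_KN.
have le_Kn : (K <= n)%N by rewrite /n; lia.
(* A nonzero integer has absolute value at least 1, and the weight r^(2i) with i < K is at least
   r^(2K). *)
have step1 : (m ^ (2 * K) * \sum_(i < K) (fcoef g i != 0) <= C ^ 2 * m.+1 ^ (2 * K))%N.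
  rewrite -(ler_nat algC) (natrM _ (m ^ _)) (natrM _ (C ^ 2)) (natrX _ m).
  rewrite (natrX _ C) (natrX _ m.+1) -ler_pdivrMr ?exprn_gt0 ?ltr0n //.
  rewrite mulrAC -expr_div_n -/r (le_trans _ sum_le) // mulrC natr_sum big_distrl /=.
  rewrite (big_ord_widen n (fun i => (fcoef g i != 0)%:R * r ^+ (2 * K)) le_Kn).
  rewrite big_mkcond; apply: ler_sum => i _; case: ifP => [lt_iK|_]; last first.
    by rewrite exprn_ge0.
  rewrite coef_map aF_coef // normrM [leRHS]exprMn normrX (ger0_norm r_ge0) -exprM.
  have [->|nz_gi] := eqVneq (fcoef g i) 0; first by rewrite mul0r mulr_ge0 ?exprn_ge0.
  rewrite mul1r -[leLHS]mul1r ler_pM ?exprn_ge0 //.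
    by rewrite exprn_ege1 // -intr_norm (ler_int _ 1) -gtz0_ge1 normr_gt0.
  by rewrite ler_wiXn2l //; lia.
have pow_le : (m.+1 ^ (2 * K) <= 2 * m ^ (2 * K))%N.
  have := bernoulli_nat_lower m (2 * K); rewrite expnSr /m.
  move: (_ ^ (2 * K))%N (_ ^ (2 * K))%N => u v; nia.
have pow_gt0 : (0 < m ^ (2 * K))%N by rewrite expn_gt0.
rewrite -(leq_pmul2l pow_gt0) (leq_trans step1) //.
have -> : (m ^ (2 * K) * (2 * C ^ 2) = C ^ 2 * (2 * m ^ (2 * K)))%N.
  by rewrite mulnCA [RHS]mulnCA [(C ^ 2 * _)%N]mulnC.
exact: leq_mul.
Qed.

(** * Reduction mod 2 and conclusion *)

Lemma sigma_sign (k : nat) (eps : nat -> bool) :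
  sigma k eps = 1 \/ sigma k eps = -1.
Proof.
rewrite /sigma; case: (_ + _) => n; rewrite /exprz -signr_odd.
  by case: odd; [right | left].
by case: odd; [right | left]; rewrite ?invr1 // invrN invr1.
Qed.

Lemma Qseries_mod2 (eps : nat -> bool) (omega : Z2adic) :
  map_fps (fun c : int => c%:~R : 'F_2) (Qseries eps omega) = Q2 omega.
Proof.
apply: fpsP => k /=; rewrite intrM -pmulrn.
have -> : (sigma k eps)%:~R = 1 :> 'F_2.
  by case: (sigma_sign k eps) => ->; apply: val_inj.
by rewrite mul1r.
Qed.

Lemma Qseries_coef_le1 (eps : nat -> bool) (omega : Z2adic) (k : nat) :
  (absz (fcoef (Qseries eps omega) k) <= 1)%N.
Proof.
rewrite /= abszM; have := binom2_half_le1 omega k.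
by case: (sigma_sign k eps) => -> /=; rewrite mul1n.
Qed.

(* The denominator can be taken primitive, so it does not vanish mod 2. *)
Lemma rational_mod2 (f : fps int) (a b : {poly int}) :
  a != 0 -> fps_of_poly a * f = fps_of_poly b ->
  fps_rational (map_fps (intr : int -> 'F_2) f).
Proof.
move=> nz_a afE; have [g def_g] : exists g, g = fps_of_poly (zprimitive a) * f by eexists.
have cgE : fps_of_poly (zcontents a)%:P * g = fps_of_poly b.
  by rewrite def_g mulrA -rmorphM mul_polyC -zpolyEprim.
(* A nonzero constant times g is a polynomial and Z is a domain, so g equals its truncation. *)
have gE : g = fps_of_poly (fps_trunc (size b) g).
  apply: fpsP => i /=; rewrite coef_poly; case: ltnP => // le_bi.
  have := congr1 (fun h => fcoef h i) cgE.
  rewrite [RHS]nth_default //= big_ord_recl coefC /= subn0 big1 => [|j _].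
    by rewrite addr0 => /eqP; rewrite mulf_eq0 zcontents_eq0 (negPf nz_a) => /eqP.
  by rewrite coefC mul0r.
apply/fps_rationalP; exists (map_poly (intr : int -> 'F_2) (zprimitive a)).
  apply/eqP => a0; suff : (2 %| zcontents (zprimitive a))%Z.
    by rewrite zcontents_primitive nz_a.
  rewrite dvdz_contents; apply/polyOverP => i.
  have := congr1 (fun p : {poly 'F_2} => p`_i) a0; rewrite coef_map coef0 /= => ai0.
  by move/eqP: ai0; rewrite -(dvdz_pcharf (pchar_Fp (isT : prime 2))).
exists (map_poly (intr : int -> 'F_2) (fps_trunc (size b) g)).
by rewrite -!map_fps_of_poly -gE def_g rmorphM.
Qed.

Theorem theorem4 (eps : nat -> bool) (omega : Z2adic) :
  ((Z2_is_int omega -> fps_is_poly (Qseries eps omega)) /\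
   (~ Z2_is_int omega ->
      fps_transcendental
        (map_fps (fun c : int => c%:~R : rat) (Qseries eps omega)))) /\
  (let Qmod2 := map_fps (fun c : int => c%:~R : 'F_2) (Qseries eps omega) in
   (fps_algebraic Qmod2 <-> Z2_is_rat omega) /\
   (fps_rational Qmod2 <-> fps_is_poly Qmod2) /\
   (fps_is_poly Qmod2 <-> Z2_is_int omega)).
Proof.
rewrite Qseries_mod2 /=; split; last first.
  split; first by split; [exact: Q2_algebraic_rat | exact: Q2_algebraic].
  by split; [exact: Q2_rational_poly | exact: Q2_poly_int].
split=> [[m ->]|nint alg].
  exists (\poly_(i < `|(m + 1)%R|%N) fcoef (Qseries eps m%:~R) i).
  apply: fpsP => i; rewrite /= coef_poly; case: ltnP => // le_mi.
  by rewrite binom2_half_int // mulr0.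
have [a nz_a [b afE]] := bounded_algebraic_rational (Qseries_coef_le1 eps omega) alg.
apply/nint/Q2_poly_int/Q2_rational_poly.
by have := rational_mod2 nz_a afE; rewrite Qseries_mod2.
Qed.
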